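(* Let $q\in(0,1)$ be fixed, and for each dimension $p$ let the sample size be $n=p/q$ (so $p/n=q$). For each integer $p\ge 1$ let $\lambda_{1,p}\ge\lambda_{2,p}\ge\dots\ge\lambda_{p,p}>0$ be the eigenvalues of the true covariance matrix $\Sigma_p$, and let $l_{1,p}\ge l_{2,p}\ge\dots\ge l_{p,p}$ be the eigenvalues of the corresponding sample covariance matrix $S_p$ computed from $n$ normal observations. For $p\ge1$ define $$J_p=\Big\{i\in\{1,\dots,p\} : \text{for all integers } m\ge p,\ \Big|\frac{\lambda_{1,m}}{\lambda_{i,m}}-1\Big|<\frac{1}{\sqrt m}\Big\},\qquad \phi(p)=|J_p|.$$ Then $\phi$ is increasing (in the non-strict sense) and has a limit in $[0,\infty]$ as $p\to\infty$, and there exists a constant $c>0$ such that $$\limsup_{p\to\infty}\mathbb{P}(l_{1,p}\le\lambda_{1,p})\ \le\ \limsup_{p\to\infty}e^{-c\,\phi(p)}=e^{-c\lim_{p\to\infty}\phi(p)}.$$ As a result, $$\lim_{p\to\infty}\phi(p)=\infty\ \Longrightarrow\ \lim_{p\to\infty}\mathbb{P}(l_{1,p}\le\lambda_{1,p})=0.$$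
   Context: For each $p$, $\Sigma_p$ is a symmetric positive definite $p\times p$ real matrix, and $X_1,\dots,X_n$ are independent random vectors in $\mathbb{R}^p$ with the normal distribution $N(\mu,\Sigma_p)$ (for some mean $\mu$). The sample covariance matrix is $S_p=\frac1n\sum_{i=1}^n (X_i-\bar X)(X_i-\bar X)^t$ with $\bar X=\frac1n\sum_{i=1}^n X_i$; thus $S_p$ has the Wishart distribution $W_p(n-1,\frac1n\Sigma_p)$. Since $q=p/n$ is fixed, limits as $p\to\infty$ of probabilities involving $S_p$ are taken along those $p$ for which $n=p/q$ is an integer. Convention: $e^{-c\cdot\infty}=0$. *)

(* Defs.v *)
From mathcomp Require Import all_boot all_order all_algebra.
From mathcomp Require Import all_classical all_reals all_analysis.

Set Implicit Arguments.
Unset Strict Implicit.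
Unset Printing Implicit Defensive.

Import Order.TTheory GRing.Theory Num.Theory.
Import numFieldTopology.Exports numFieldNormedType.Exports.

Local Open Scope classical_set_scope.
Local Open Scope ring_scope.

Definition posdefmx {R : realType} {p : nat} (A : 'M[R]_p) : Prop :=
  A^T = A /\ forall v : 'cV[R]_p, v != 0 -> 0 < (v^T *m A *m v) 0 0.

(* The eigenvalues of [A], repeated according to multiplicity and listed in
   nonincreasing order. Such a list is unique if it exists, and it exists when
   [A] is symmetric; the value is [::] if the characteristic polynomial of [A]
   does not split over [R]. *)
Definition eigenvalues {R : realType} {p : nat} (A : 'M[R]_p) : seq R :=
  xget [::] [set s | sorted >=%R s /\
                     char_poly A = \prod_(x <- s) ('X - x%:P)].

(* Numbering starts at 0: [eigenval A 0] is the largest eigenvalue. *)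
Definition eigenval {R : realType} {p : nat} (A : 'M[R]_p) (i : nat) : R :=
  (eigenvalues A)`_i.

Definition sample_mean {R : realType} {n p : nat} (x : 'I_n -> 'cV[R]_p) :
    'cV[R]_p :=
  n%:R^-1 *: \sum_i x i.

Definition sample_cov {R : realType} {n p : nat} (x : 'I_n -> 'cV[R]_p) :
    'M[R]_p :=
  n%:R^-1 *: \sum_i (x i - sample_mean x) *m (x i - sample_mean x)^T.

(* R^p with its Borel sigma-algebra. *)
Definition borel_cV (R : realType) (p : nat) :=
  g_sigma_algebraType (@open 'cV[R]_p).

Definition random_vector {R : realType} {d : measure_display}
    {T : measurableType d} {p : nat} (X : T -> 'cV[R]_p) : Prop :=
  measurable_fun [set: T] (X : T -> borel_cV R p).

(* [X] has the distribution N(mu, Sigma): every nonzero linear combination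
   a^t X has the univariate distribution N(a^t mu, a^t Sigma a). The second
   parameter of [normal_prob] is the standard deviation; it is nonzero here
   as soon as Sigma is positive definite. *)
Definition normal_vector {R : realType} {d : measure_display}
    {T : measurableType d} (P : probability T R) {p : nat}
    (mu : 'cV[R]_p) (Sigma : 'M[R]_p) (X : T -> 'cV[R]_p) : Prop :=
  random_vector X /\
  forall a : 'cV[R]_p, a != 0 -> forall B : set R, measurable B ->
    P [set w | B ((a^T *m X w) 0 0)] =
    normal_prob ((a^T *m mu) 0 0) (Num.sqrt ((a^T *m Sigma *m a) 0 0)) B.

(* Mutual independence of random vectors. *)
Definition independent_vectors {R : realType} {d : measure_display}
    {T : measurableType d} (P : probability T R) {n p : nat}
    (X : 'I_n -> T -> 'cV[R]_p) : Prop :=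
  forall (K : {set 'I_n}) (B : 'I_n -> set (borel_cV R p)),
    (forall i, i \in K -> measurable (B i)) ->
    P (\bigcap_(i in [set i | i \in K]) (X i @^-1` B i)) =
    (\prod_(i in K) P (X i @^-1` B i))%E.

(* The dimensions p >= 1 for which n = p / q is an integer, and that n. *)
Definition admissible {R : realType} (q : R) : set nat :=
  [set p | (0 < p)%N /\ p%:R / q \is a Num.nat].

Definition sample_size {R : realType} (q : R) (p : nat) : nat :=
  Num.truncn (p%:R / q).

Definition J {R : realType} (Sigma : forall p, 'M[R]_p) (p : nat) :
    {set 'I_p} :=
  [set i : 'I_p | `[< forall m, (p <= m)%N ->
     `|eigenval (Sigma m) 0 / eigenval (Sigma m) i - 1|
       < (Num.sqrt m%:R)^-1 >]]%SET.

Definition phi {R : realType} (Sigma : forall p, 'M[R]_p) (p : nat) : nat :=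
  #|J Sigma p|.

(* Main.v *)
(* Let u_i be orthonormal eigenvectors of Sigma_p, with eigenvalues lambda_i,
   let Y_ij = u_i^t (X_j - mu) / sqrt lambda_i, and Q_i = sum_j Y_ij^2. Testing
   the sample covariance matrix on the u_i with i in J_p shows that, if
   l_1 <= lambda_1, then Q_i <= n + C sqrt n for all i in J_p, with
   C = 1 + 1 / sqrt q, except on an event of probability O(1 / sqrt p) where
   some sample mean of the Y_ij is large. The variables
   z_i = exp (C (Q_i - n) / sqrt n) have explicit joint moments, which factor
   over i. Choose a polynomial f >= 0 on [0, +oo[, with f >= 1 wherever
   Q_i <= n + C sqrt n and E f(z_i) <= 1 - eps for some eps depending only on
   q. Then P(l_1 <= lambda_1) <= E prod_i f(z_i) + O(1 / sqrt p)
   <= (1 - eps)^phi(p) + O(1 / sqrt p), so that c = - ln (1 - eps) works.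

   Independence over i need not be derived from the Gaussian hypothesis: only
   moments E exp (sum_ij t_ij Y_ij^2) with t_ij >= 0 appear, and these follow
   from the laws of the linear combinations of the Y_ij. *)
Require Import Defs.
From mathcomp Require Import all_boot all_order all_algebra.
From mathcomp Require Import all_classical all_reals all_analysis.
From mathcomp Require Import ring lra.
From mathcomp Require Import measurable_realfun perm complex.

Set Implicit Arguments.
Unset Strict Implicit.
Unset Printing Implicit Defensive.

Import Order.TTheory GRing.Theory Num.Theory.
Import numFieldTopology.Exports numFieldNormedType.Exports.

Local Open Scope classical_set_scope.
Local Open Scope ring_scope.

(** * Spectral theorem for real symmetric matrices *)

Section spectral.
Context {R : realType}.

Lemma sqnormE n (v : 'cV[R]_n) : (v^T *m v) 0 0 = \sum_i v i 0 ^+ 2.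
Proof. by rewrite mxE; apply: eq_bigr => i _; rewrite mxE. Qed.

Lemma sqnorm_ge0 n (v : 'cV[R]_n) : 0 <= (v^T *m v) 0 0.
Proof. by rewrite sqnormE sumr_ge0// => i _; rewrite sqr_ge0. Qed.

Lemma sqnorm_eq0 n (v : 'cV[R]_n) : ((v^T *m v) 0 0 == 0) = (v == 0).
Proof.
apply/idP/idP => [|/eqP ->]; last by rewrite mulmx0 mxE.
rewrite sqnormE psumr_eq0; last by move=> i _; rewrite sqr_ge0.
move=> /allP h; apply/eqP/matrixP => i j; rewrite ord1 mxE.
by have /h := mem_index_enum i; rewrite sqrf_eq0 => /eqP.
Qed.

(* A non-real eigenvalue a + ib would make (A - a)^2 + b^2 singular. *)
Lemma sym_eigenvector n (A : 'M[R]_n.+1) : A^T = A ->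
  exists a (v : 'cV[R]_n.+1), v != 0 /\ A *m v = a *: v.
Proof.
move=> symA.
pose f := [the {rmorphism R -> R[i]} of real_complex R].
have [z /eigenvalueP[x xA x0]] := eigenvalue_closed (map_mx f A) (ltn0Sn n).
pose a := complex.Re z; pose b := complex.Im z.
pose B := A - a%:M; pose M := B *m B + (b ^+ 2)%:M.
have zE : (z - f a) ^+ 2 + f (b ^+ 2) = 0.
  rewrite /a /b; case: z {xA a b B M} => a b /=; apply/eqP; rewrite eq_complex/=.
  by apply/andP; split; apply/eqP; ring.
have xB : x *m map_mx f B = (z - f a) *: x.
  by rewrite map_mxB map_scalar_mx mulmxBr xA mul_mx_scalar scalerBl.
have xM : x *m map_mx f M = 0.
  rewrite map_mxD map_mxM map_scalar_mx mulmxDr mulmxA xB -scalemxAl xB.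
  by rewrite mul_mx_scalar scalerA -expr2 -scalerDl zE scale0r.
have dM : \det M = 0.
  apply/eqP; rewrite -(fmorph_eq0 f) -det_map_mx; apply/det0P.
  by exists x.
have /eqP/det0P[v v0 vM] := dM.
have symB : B^T = B by rewrite linearB/= tr_scalar_mx symA.
pose w := v *m B.
(* Pairing [v *m M = 0] with [v^T] writes zero as a sum of two nonnegative terms. Hence [w = 0], and
   [v] is already an eigenvector for the real part [a]. *)
have e : (w *m w^T) 0 0 + b ^+ 2 * (v *m v^T) 0 0 = 0.
  have : (v *m M *m v^T) 0 0 = 0 by rewrite vM mul0mx mxE.
  rewrite /M mulmxDr mulmxDl mxE mul_mx_scalar -scalemxAl [X in _ + X]mxE.
  by rewrite /w trmx_mul symB !mulmxA.
have w0 : 0 <= (w *m w^T) 0 0 by rewrite -{1}[w]trmxK sqnorm_ge0.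
have v0' : 0 <= (v *m v^T) 0 0 by rewrite -{1}[v]trmxK sqnorm_ge0.
have wz : (w *m w^T) 0 0 = 0.
  have := mulr_ge0 (sqr_ge0 b) v0'; lra.
exists a, v^T; split; first by rewrite trmx_eq0.
have : w = 0.
  by apply/eqP; rewrite -trmx_eq0 -sqnorm_eq0 trmxK wz.
rewrite /w /B mulmxBr mul_mx_scalar => /eqP; rewrite subr_eq0 => /eqP h.
by rewrite -[in LHS]symA -trmx_mul h linearZ.
Qed.

(** The reflection along [w = u - e] exchanges the unit vectors [e] and [u]. It is undefined when
    [w = 0], whence the separate case [u = e]. *)
Lemma householder n (u : 'cV[R]_n.+1) : (u^T *m u) 0 0 = 1 ->
  exists2 H : 'M[R]_n.+1, H^T = H /\ H *m H = 1%:M & H *m delta_mx 0 0 = u.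
Proof.
move=> u1; pose e : 'cV[R]_n.+1 := delta_mx 0 0.
have [ue|ue] := eqVneq u e.
  by exists 1%:M; [rewrite trmx1 mulmx1|rewrite mul1mx ue].
pose w := u - e; pose k := (w^T *m w) 0 0.
have k0 : k != 0 by rewrite sqnorm_eq0 subr_eq0.
have ee : (e^T *m e) 0 0 = 1.
  by rewrite trmx_delta mul_delta_mx mxE !eqxx.
have euue : (e^T *m u) 0 0 = (u^T *m e) 0 0.
  by rewrite -[in LHS](trmxK u) -trmx_mul mxE.
have kE : k = 2 - 2 * (u^T *m e) 0 0.
  rewrite /k /w [(u - e)^T]linearB/= mulmxBl !mulmxBr !mxE.
  move: u1 ee euue; rewrite !mxE => -> -> ->.
  ring.
have we : (w^T *m e) 0 0 = - k / 2.
  by rewrite kE /w [(u - e)^T]linearB/= mulmxBl !mxE; move: ee; rewrite !mxE => ->; field.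
exists (1%:M - (2 / k) *: (w *m w^T)); first split.
- by rewrite [LHS]linearB/= trmx1 linearZ/= trmx_mul trmxK.
- rewrite mulmxBl mul1mx mulmxBr mulmx1 -scalemxAl -scalemxAr.
  have -> : w *m w^T *m (w *m w^T) = k *: (w *m w^T).
    rewrite mulmxA -[_ *m w^T *m w]mulmxA [w^T *m w]mx11_scalar -/k.
    by rewrite mul_mx_scalar -scalemxAl.
  rewrite !scalerA opprB addrC addrA.
  have -> : 2 / k * (2 / k) * k = 2 / k + 2 / k by field.
  by rewrite scalerDl addrK addrC addKr.
- rewrite mulmxBl mul1mx -scalemxAl -mulmxA [w^T *m _]mx11_scalar we mul_mx_scalar.
  rewrite scalerA; have -> : 2 / k * (- k / 2) = -1 by field.
  by rewrite scaleN1r opprK /w addrC subrK.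
Qed.

(** Conjugating by a reflection that sends the first basis vector to a unit eigenvector makes the
    first column a multiple of that basis vector. By symmetry the first row follows, and the
    induction applies to the lower right block. *)
Lemma sym_diagonalize n (A : 'M[R]_n) : A^T = A ->
  exists2 U : 'M[R]_n, U^T *m U = 1%:M &
    exists d : 'rV[R]_n, A = U *m diag_mx d *m U^T.
Proof.
elim: n A => [|n IH] A symA.
  exists 1%:M; first by rewrite trmx1 mulmx1.
  by exists 0; apply/matrixP => -[].
have [a [v [v0 Av]]] := sym_eigenvector symA.
pose s := (v^T *m v) 0 0; have s0 : 0 < s by rewrite lt_neqAle sqnorm_ge0 eq_sym sqnorm_eq0 v0.
pose u := (Num.sqrt s)^-1 *: v.
have u1 : (u^T *m u) 0 0 = 1.
  rewrite /u [(_ *: v)^T]linearZ/= -scalemxAl -scalemxAr scalerA mxE -/s -expr2 exprVn sqr_sqrtr ?ltW//.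
  by rewrite mulVf// gt_eqF.
have Au : A *m u = a *: u by rewrite /u -scalemxAr Av !scalerA mulrC.
have [H [HT HH] He] := householder u1.
have [B BHAH] : exists B : 'M[R]_(1 + n), B = H *m A *m H by eexists.
have Be : B *m delta_mx 0 0 = a *: delta_mx 0 (0 : 'I_1).
  rewrite BHAH -(mulmxA _ H) He -mulmxA Au -scalemxAr.
  by rewrite -{1}He mulmxA HH mul1mx.
have symB : B^T = B by rewrite BHAH !trmx_mul HT symA mulmxA.
have [U UU [d dE]] : exists2 U : 'M[R]_n, U^T *m U = 1%:M & exists d, drsubmx B = U *m diag_mx d *m U^T
  by apply: IH; rewrite trmx_drsub symB.
have colE (M : 'M[R]_(1 + n)) i : (M *m delta_mx 0 (0 : 'I_1)) i 0 = M i 0.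
  rewrite mxE (bigD1 0)//= big1 ?addr0 ?mxE ?eqxx ?mulr1// => j j0.
  by rewrite mxE (negbTE j0) mulr0.
have dl0 : dlsubmx B = 0.
  apply/matrixP => i j; rewrite ord1 !mxE.
  have -> : lshift n (0 : 'I_1) = 0 by apply/val_inj.
  by rewrite -colE Be !mxE mulr0.
have ul : ulsubmx B = a%:M.
  apply/matrixP => i j; rewrite !ord1 !mxE.
  have -> : lshift n (0 : 'I_1) = 0 by apply/val_inj.
  by rewrite -colE Be !mxE !eqxx mulr1.
have ur0 : ursubmx B = 0.
  by rewrite -[ursubmx B]trmxK trmx_ursub symB dl0 trmx0.
have BE : B = block_mx a%:M 0 0 (drsubmx B) by rewrite -[LHS]submxK ul ur0 dl0.
pose U' : 'M[R]_(1 + n) := block_mx 1%:M 0 0 U.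
have UT : U'^T = block_mx 1%:M 0 0 U^T by rewrite tr_block_mx !trmx0 trmx1.
have UU' : U'^T *m U' = 1%:M.
  rewrite UT mulmx_block !mul0mx !mulmx0 !addr0 !add0r.
  by rewrite mulmx1 UU -scalar_mx_block.
have BU : B = U' *m diag_mx (row_mx a%:M d) *m U'^T.
  rewrite UT diag_mx_row mulmx_block !mul0mx !mulmx0 !addr0 !add0r mul1mx.
  rewrite mulmx_block !mul0mx !mulmx0 !addr0 !add0r mulmx1 -dE [LHS]BE.
  by congr block_mx; apply/matrixP => i j; rewrite !ord1 !mxE.
exists (H *m U').
  by rewrite trmx_mul -mulmxA (mulmxA _ H) HT HH mul1mx.
exists (row_mx a%:M d).
have AE : A = H *m B *m H.
  by rewrite BHAH !mulmxA HH mul1mx -mulmxA HH mulmx1.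
by rewrite [LHS]AE trmx_mul HT BU !mulmxA.
Qed.

Lemma sym_diagonalize_sorted n (A : 'M[R]_n) : A^T = A ->
  exists U : 'M[R]_n, exists s : seq R,
    [/\ U^T *m U = 1%:M, sorted >=%R s, size s = n &
        A = U *m diag_mx (\row_i s`_i) *m U^T].
Proof.
move=> /sym_diagonalize[U UU [d AE]].
pose t := [tuple d 0 i | i < n].
pose s := sort >=%R t.
have szs : size s = n by rewrite size_sort size_tuple.
have ge_tot : total (>=%R : rel R) by move=> x y; exact: le_total.
have : perm_eq s t by rewrite perm_sort.
move=> /tuple_permP[pi sE].
have sdE (k : 'I_n) : s`_k = d 0 (pi k).
  by rewrite sE -tnth_nth !tnth_mktuple.
pose U' := \matrix_(i, k) U i (pi k).
exists U', s; split => //; last 1 first.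
- rewrite AE; apply/matrixP => i j; rewrite !mxE (reindex_inj (@perm_inj _ pi))/=.
  apply: eq_bigr => k _; rewrite !mul_mx_diag !mxE sdE.
  by [].
- apply/matrixP => i j; rewrite mxE.
  transitivity ((U^T *m U) (pi i) (pi j)).
    by rewrite mxE; apply: eq_bigr => k _; rewrite !mxE.
  by rewrite UU !mxE (inj_eq perm_inj).
- exact: sort_sorted.
Qed.

(** The characteristic polynomial is invariant under conjugation by [U] and determines its roots up
    to order. Sorting fixes the order, so the choice made by [xget] is forced. *)
Lemma eigenvaluesE n (A U : 'M[R]_n) (s : seq R) :
  U^T *m U = 1%:M -> sorted >=%R s -> size s = n ->
  A = U *m diag_mx (\row_i s`_i) *m U^T -> eigenvalues A = s.
Proof.
move=> UU ss szs AE.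
have UU' : U *m U^T = 1%:M by exact: mulmx1C.
have cpA : char_poly A = \prod_(x <- s) ('X - x%:P).
  pose D := diag_mx (\row_i s`_i) : 'M[R]_n.
  have -> : char_poly A = char_poly D.
    rewrite /char_poly.
    pose V := map_mx polyC U.
    have VV : V *m V^T = 1%:M by rewrite /V map_trmx -map_mxM UU' map_mx1.
    have -> : char_poly_mx A = V *m char_poly_mx D *m V^T.
      rewrite /char_poly_mx AE !map_mxM -map_trmx -/V -/D mulmxBr mulmxBl mul_mx_scalar.
      by rewrite -scalemxAl VV scalemx1.
    by rewrite !det_mulmx mulrAC -det_mulmx VV det1 mul1r.
  rewrite char_poly_trig ?diag_mx_is_trig//.
  rewrite (big_nth 0) big_mkord szs; apply: eq_bigr => i _.
  by rewrite !mxE eqxx mulr1n.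
rewrite /eigenvalues; apply: xget_unique => //= t [st tE].
apply: (@sorted_eq _ >=%R) => //.
- by move=> y x z xy yz; exact: le_trans yz xy.
- by move=> x y /andP[/= xy yx]; apply/eqP; rewrite eq_le xy yx.
by apply: prod_XsubC_eq; rewrite -tE.
Qed.

Lemma sym_spectral n (A : 'M[R]_n) : A^T = A ->
  exists2 U : 'M[R]_n, U^T *m U = 1%:M &
  [/\ A = U *m diag_mx (\row_i eigenval A i) *m U^T,
    sorted >=%R (eigenvalues A) & size (eigenvalues A) = n].
Proof.
move=> /sym_diagonalize_sorted[U [s [UU ss szs AE]]]; exists U => //.
by rewrite /eigenval (eigenvaluesE UU ss szs AE).
Qed.

Lemma diag_quadratic n (d : 'rV[R]_n) (v : 'cV[R]_n) :
  (v^T *m diag_mx d *m v) 0 0 = \sum_i d 0 i * v i 0 ^+ 2.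
Proof.
by rewrite mul_mx_diag mxE; apply: eq_bigr => i _; rewrite !mxE; ring.
Qed.

(** Rayleigh's principle: in the eigenbasis the form is a weighted sum of squares with weights at
    most the first eigenvalue, and the first column of [U] attains that weight. *)
Lemma eigenval0_leP n (A : 'M[R]_n.+1) (lam : R) : A^T = A ->
  eigenval A 0 <= lam <->
  forall v : 'cV[R]_n.+1, (v^T *m A *m v) 0 0 <= lam * (v^T *m v) 0 0.
Proof.
move=> /sym_spectral[U UU [AE sA szA]].
have ge_trans : transitive (>=%R : rel R) by move=> y x z xy yz; exact: le_trans yz xy.
have UU' : U *m U^T = 1%:M by exact: mulmx1C.
split=> [Al v|/(_ (col 0 U))].
  rewrite AE; pose w := U^T *m v.
  have -> : v^T *m (U *m diag_mx (\row_i eigenval A i) *m U^T) *m v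
      = w^T *m diag_mx (\row_i eigenval A i) *m w.
    by rewrite /w trmx_mul trmxK !mulmxA.
  have -> : v^T *m v = w^T *m w.
    by rewrite /w trmx_mul trmxK mulmxA -(mulmxA _ U) UU' mulmx1.
  rewrite diag_quadratic sqnormE mulr_sumr; apply: ler_sum => i _.
  rewrite ler_wpM2r ?sqr_ge0// mxE (le_trans _ Al)//.
  have [i0|i0] := posnP i; first by rewrite i0.
  by apply: (sorted_ltn_nth ge_trans 0 sA) => //; rewrite inE szA.
have cE : U^T *m col 0 U = delta_mx 0 0.
  by rewrite colE mulmxA UU mul1mx.
have -> : (col 0 U)^T *m A *m col 0 U =
    (delta_mx 0 0 : 'cV_n.+1)^T *m diag_mx (\row_i eigenval A i) *m
    (delta_mx 0 0 : 'cV_n.+1).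
  by rewrite -cE {1}AE !trmx_mul trmxK !mulmxA.
rewrite diag_quadratic (bigD1 0)//= big1 => [|i i0]; last first.
  by rewrite [_ i 0]mxE (negbTE i0) expr0n mulr0.
have -> : ((col 0 U)^T *m col 0 U) 0 0 = 1.
  have := congr1 (fun M : 'M[R]_n.+1 => M 0 0) UU; rewrite [RHS]mxE eqxx mulr1n => <-.
  rewrite !mxE.
  by apply: eq_bigr => i _; rewrite !mxE.
by rewrite addr0 mulr1 !mxE expr1n mulr1.
Qed.

End spectral.

(** * Expectation of a product of independent variables *)

Section weighted_integral.
Context d d' (T : measurableType d) (T' : measurableType d') (R : realType).
Variables (m : {measure set T -> \bar R}) (W : T -> R) (U : T -> T').
Hypotheses (W0 : forall x, 0 <= W x) (mW : measurable_fun setT W)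
  (mU : measurable_fun setT U).
Import HBNNSimple.

Let weighted_indicator B : measurable B ->
  measurable_fun setT (fun x => (W x * \1_B (U x))%:E).
Proof.
move=> mB; apply/measurable_EFinP; apply: measurable_funM => //.
by apply: measurableT_comp => //; exact: measurable_indic.
Qed.

Lemma integral_weighted_nnsfun (h : {nnsfun T' >-> R}) :
  (\int[m]_x (W x * h (U x))%:E =
  \sum_(y \in range h) y%:E * \int[m]_x (W x * \1_(h @^-1` [set y]) (U x))%:E)%E.
Proof.
transitivity (\int[m]_x \sum_(y \in range h)
    (y%:E * (W x * \1_(h @^-1` [set y]) (U x))%:E))%E.
  apply: eq_integral => x _; rewrite [in LHS]fimfunE mulr_fsumr// -fsumEFin//.
  by apply: eq_fsbigr => y _; rewrite -EFinM mulrCA.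
rewrite ge0_integral_fsum//.
- apply: eq_fsbigr => y /set_mem[t _ <-].
  rewrite ge0_integralZl//.
  + exact: weighted_indicator.
  + by move=> x _; rewrite lee_fin mulr_ge0.
  + by rewrite lee_fin.
- by move=> y; apply: emeasurable_funM => //; exact: weighted_indicator.
- move=> y x _; rewrite -EFinM mulrCA EFinM mule_ge0 ?lee_fin//.
  exact: nnfun_muleindic_ge0.
Qed.

Lemma integral_weighted_approx (g : T' -> R) (mg : measurable_fun setT (EFin \o g)) :
  (forall x, 0 <= g x) ->
  (\int[m]_x (W x * g (U x))%:E =
  limn (fun n => \int[m]_x (W x * nnsfun_approx measurableT mg n (U x))%:E))%E.
Proof.
move=> g0.
have gE x : ((W x * g (U x))%:E =
    lim ((W x * nnsfun_approx measurableT mg n (U x))%:E @[n --> \oo]))%E.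
  apply/esym/cvg_lim => //; rewrite EFinM; under eq_fun do rewrite EFinM.
  apply: cvgeZl => //.
  by apply: cvg_nnsfun_approx => //= y _; rewrite lee_fin.
under eq_integral => x _ do rewrite gE.
apply: monotone_convergence => //.
- move=> n; apply/measurable_EFinP; apply: measurable_funM => //.
  exact: measurableT_comp.
- by move=> n x _; rewrite lee_fin mulr_ge0.
- move=> x _ a b ab; rewrite lee_fin ler_wpM2l//.
  exact/lefP/nd_nnsfun_approx.
Qed.
End weighted_integral.

Section weighted_integral_ext.
Import HBNNSimple.

(** Equality of the two weighted image measures on sets passes to simple functions by linearity,
    then to nonnegative functions by monotone convergence. This serves both for independence, where
    the weight is the product of the other factors, and for a normal law, where the weight is the
    density. *)
Lemma weighted_integral_ext d1 d2 d3 (T1 : measurableType d1) (T2 : measurableType d2)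
    (T3 : measurableType d3) (R : realType)
    (m1 : {measure set T1 -> \bar R}) (m2 : {measure set T2 -> \bar R})
    (W1 : T1 -> R) (W2 : T2 -> R) (U1 : T1 -> T3) (U2 : T2 -> T3) (g : T3 -> R) :
  (forall x, 0 <= W1 x) -> measurable_fun setT W1 -> measurable_fun setT U1 ->
  (forall x, 0 <= W2 x) -> measurable_fun setT W2 -> measurable_fun setT U2 ->
  (forall x, 0 <= g x) -> measurable_fun setT g ->
  (forall B, measurable B -> \int[m1]_x (W1 x * \1_B (U1 x))%:E =
    \int[m2]_x (W2 x * \1_B (U2 x))%:E)%E ->
  (\int[m1]_x (W1 x * g (U1 x))%:E = \int[m2]_x (W2 x * g (U2 x))%:E)%E.
Proof.
move=> W10 mW1 mU1 W20 mW2 mU2 g0 mg h.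
have mg' : measurable_fun setT (EFin \o g) by exact/measurable_EFinP.
rewrite !(integral_weighted_approx _ _ _ _ mg')//.
congr (limn _); apply/funext => n; rewrite !integral_weighted_nnsfun//.
by apply: eq_fsbigr => y _; rewrite h.
Qed.

End weighted_integral_ext.

Lemma measurable_coord (R : realType) p (i : 'I_p) :
  measurable_fun [set: borel_cV R p] (fun x : borel_cV R p => (x : 'cV[R]_p) i 0).
Proof.
apply: (measurability _ (RGenOpens.measurableE R)).
move=> _ [_ [a [b ->] <-]]; rewrite setTI.
apply: sub_sigma_algebra.
have : continuous (fun M : 'cV[R]_p => M i 0) by exact: coord_continuous.
move=> /continuousP; apply; exact: interval_open.
Qed.

Lemma random_vector_coord (R : realType) d (T : measurableType d) p
    (X : T -> 'cV[R]_p) i :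
  random_vector X -> measurable_fun setT (fun w => X w i 0).
Proof. by move=> mX; apply: (measurableT_comp (measurable_coord i) mX). Qed.

Lemma prodEFin (R : realType) I (r : seq I) (Q : pred I) (F : I -> R) :
  (\prod_(i <- r | Q i) (F i)%:E = (\prod_(i <- r | Q i) F i)%:E)%E.
Proof. by rewrite (big_morph EFin (fun x y => EFinM x y) (erefl 1%:E)). Qed.

Section independence.
Context d (T : measurableType d) (R : realType) (P : probability T R).

Lemma prod_indic n (V : 'I_n -> T -> R) (B : 'I_n -> set R) x :
  \prod_i \1_(B i) (V i x) =
  \1_(\bigcap_(i in [set i | i \in [set: 'I_n]%SET]) (V i @^-1` B i)) x :> R.
Proof.
rewrite indicE; case: (boolP (_ \in _)) => [|].
  rewrite inE => h; rewrite big1// => i _; rewrite indicE mem_set//.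
  by apply: h; rewrite /= inE.
rewrite notin_setE => h.
have [i hi] : exists i, ~ B i (V i x).
  by apply: contrapT => /forallNP h'; apply: h => i _; apply: contrapT; exact: h'.
by rewrite (bigD1 i)//= indicE memNset// mul0r.
Qed.

(* The indicators of the events [V i \in B i] are replaced by the variables
   [V i] one index at a time. *)
Lemma expectation_prod_indep n (V : 'I_n -> T -> R) (e : 'I_n -> R) :
  (forall i, measurable_fun setT (V i)) -> (forall i x, 0 <= V i x) ->
  (forall i, \int[P]_x (V i x)%:E = (e i)%:E)%E ->
  (forall B : 'I_n -> set R, (forall i, measurable (B i)) ->
    P (\bigcap_(i in [set i | i \in [set: 'I_n]%SET]) (V i @^-1` B i)) =
    \prod_i P (V i @^-1` B i))%E ->
  (\int[P]_x (\prod_i V i x)%:E = (\prod_i e i)%:E)%E.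
Proof.
move=> mV V0 Ve indep.
have e0 i : 0 <= e i.
  rewrite -lee_fin -Ve integral_ge0// => x _; rewrite lee_fin. exact: V0.
have mpre i B : measurable B -> measurable (V i @^-1` B).
  by move=> mB; rewrite -[X in measurable X]setTI; exact: mV.
pose F k (B : 'I_n -> set R) (i : 'I_n) x :=
  if (i < k)%N then V i x else \1_(B i) (V i x).
pose f k (B : 'I_n -> set R) (i : 'I_n) :=
  if (i < k)%N then e i else fine (P (V i @^-1` B i)).
have F0 k B i x : 0 <= F k B i x by rewrite /F; case: ifP.
have f0 k B i : 0 <= f k B i.
  by rewrite /f; case: ifP => // _; rewrite fine_ge0.
have mF k B i : measurable (B i) -> measurable_fun setT (F k B i).
  move=> mB; rewrite /F; case: (i < k)%N; first exact: mV.
  by apply: measurableT_comp (mV i); exact: measurable_indic.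
suff h k : (k <= n)%N -> forall B : 'I_n -> set R, (forall i, measurable (B i)) ->
    (\int[P]_x (\prod_i F k B i x)%:E = (\prod_i f k B i)%:E)%E.
  have := h n (leqnn n) (fun=> setT) (fun=> measurableT).
  rewrite /F /f => hn.
  transitivity (\prod_(i < n) if (i < n)%N then e i
      else fine (P (V i @^-1` [set: R])))%:E; last first.
    by congr EFin; apply: eq_bigr => i _; rewrite ltn_ord.
  rewrite -hn; apply: eq_integral => x _; congr EFin.
  by apply: eq_bigr => i _; rewrite ltn_ord.
elim: k => [_ B mB|k IH kn B mB].
  under eq_integral => x _ do rewrite /F/= prod_indic.
  rewrite integral_indic//; last first.
    apply: fin_bigcap_measurable => [|i _]; [exact: finite_finset|exact: mpre].
  rewrite setIT; transitivity (\prod_i P (V i @^-1` B i))%E; first exact: indep.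
  rewrite -prodEFin; apply: eq_bigr => i _.
  by rewrite /f/= fineK// fin_num_measure//; exact: mpre.
pose j := Ordinal kn.
pose W x := \prod_(i | i != j) F k.+1 B i x.
pose c := \prod_(i | i != j) f k.+1 B i.
have c0 : 0 <= c by rewrite /c prodr_ge0.
have ltk (i : 'I_n) : i != j -> (i < k.+1)%N = (i < k)%N.
  move=> ij; rewrite ltnS leq_eqVlt; case: eqP => //= ik.
  by move/eqP: ij; case; apply/val_inj.
have mW : measurable_fun setT W.
  rewrite /W; under eq_fun do rewrite big_mkcond.
  apply: measurable_prod => i _; case: (i != j) => /=; last exact: measurable_cst.
  exact: mF.
(* [weighted_integral_ext] wants a function nonnegative on all of [R]; [g] is one and fixes the
   values of [V j]. *)
pose g (y : R) := Num.max y 0.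
have mg : measurable_fun setT g by apply: measurable_maxr.
have gV x : g (V j x) = V j x by rewrite /g max_l.
transitivity (\int[P]_x (W x * g (V j x))%:E)%E.
  apply: eq_integral => x _; congr EFin; rewrite (bigD1 j)//= mulrC gV.
  by congr (_ * _); rewrite /F ltnSn.
rewrite (@weighted_integral_ext _ _ _ _ _ _ _ _ P W (cst c) (V j) (V j))//.
- transitivity (\int[P]_x (c%:E * (V j x)%:E))%E.
    by apply: eq_integral => x _; rewrite gV EFinM.
  rewrite ge0_integralZl//; last 2 first.
    + exact/measurable_EFinP.
    + by move=> x _; rewrite lee_fin.
  rewrite Ve -EFinM; congr EFin; rewrite [RHS](bigD1 j)//= mulrC; congr (_ * _).
  by rewrite /f ltnSn.
- by move=> x; rewrite /W prodr_ge0.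
- by move=> y; rewrite /g le_max lexx orbT.
move=> B' mB'.
(* Putting [B'] at index [j] turns the integral with an indicator into an instance of the induction
   hypothesis, which is why that hypothesis quantifies over [B]. *)
pose B2 i := if i == j then B' else B i.
have mB2 i : measurable (B2 i) by rewrite /B2; case: ifP.
transitivity (\int[P]_x (\prod_i F k B2 i x)%:E)%E.
  apply: eq_integral => x _; congr EFin; rewrite [RHS](bigD1 j)//= mulrC; congr (_ * _).
    by rewrite /F ltnn /B2 eqxx.
  by apply: eq_bigr => i ij; rewrite /F /B2 (negbTE ij) ltk.
rewrite (IH (ltnW kn))//.
transitivity (\int[P]_x (c%:E * (\1_B' (V j x))%:E))%E; last first.
  by apply: eq_integral => x _; rewrite EFinM.
rewrite ge0_integralZl//; last 1 first.
- apply/measurable_EFinP; apply: (measurableT_comp _ (mV j)).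
  exact: measurable_indic.
have -> : (\int[P]_x (\1_B' (V j x))%:E = P (V j @^-1` B'))%E.
  by rewrite (integral_indic P measurableT (mpre j _ mB')) setIT.
rewrite (bigD1 j)//= mulrC EFinM; congr (_ * _)%E.
  by congr EFin; apply: eq_bigr => i ij; rewrite /f /B2 (negbTE ij) ltk.
by rewrite /f ltnn /B2 eqxx fineK// fin_num_measure//; exact: mpre.
Qed.

End independence.

(** * Exponential moments of Gaussian variables *)

Section gaussian_integrals.
Context {R : realType}.
Notation leb := (@lebesgue_measure R).

Lemma normal_pdf_unfold (m s x : R) : s != 0 ->
  normal_pdf m s x = (Num.sqrt (s ^+ 2 * pi *+ 2))^-1 *
    expR (- (x - m) ^+ 2 / (s ^+ 2 *+ 2)).
Proof. by move=> s0; rewrite normal_pdfE. Qed.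

Lemma integral_normal_pdfZ (c m s : R) : 0 <= c ->
  (\int[leb]_x (c * normal_pdf m s x)%:E = c%:E)%E.
Proof.
move=> c0; under eq_integral do rewrite EFinM.
rewrite ge0_integralZl//; last 2 first.
- by apply/measurable_EFinP; exact: measurable_normal_pdf.
- by move=> x _; rewrite lee_fin normal_pdf_ge0.
by rewrite integral_normal_pdf mule1.
Qed.

(** Completing the square turns the integrand into a constant times the normal density with mean
    [m + a * s ^+ 2]. *)
Lemma normal_mgf (m s a : R) : s != 0 ->
  (\int[leb]_x (normal_pdf m s x * expR (a * (x - m)))%:E =
  (expR (a ^+ 2 * s ^+ 2 / 2))%:E)%E.
Proof.
move=> s0; rewrite -(@integral_normal_pdfZ _ (m + a * s ^+ 2) s) ?expR_ge0//.
apply: eq_integral => x _; congr EFin.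
rewrite !normal_pdf_unfold// -[LHS]mulrA [RHS]mulrCA; congr (_ * _).
rewrite -!expRD; congr expR; field.
by [].
Qed.

(** The integrand is a multiple of the centered normal density of variance [(1 - 2 * t)^-1]. *)
Lemma normal_sq_mgf (t : R) : 0 <= t < 1 / 2 ->
  (\int[leb]_x (normal_pdf 0 1 x * expR (t * x ^+ 2))%:E =
  ((Num.sqrt (1 - 2 * t))^-1)%:E)%E.
Proof.
move=> /andP[t0 t12]; have v0 : 0 < 1 - 2 * t by lra.
pose v := Num.sqrt (1 - 2 * t).
have vgt0 : 0 < v by rewrite sqrtr_gt0.
have vE : v ^+ 2 = 1 - 2 * t by rewrite sqr_sqrtr// ltW.
rewrite -(@integral_normal_pdfZ _ 0 v^-1) ?invr_ge0 ?ltW//.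
apply: eq_integral => x _; congr EFin.
rewrite !normal_pdf_unfold ?oner_eq0 ?invr_eq0 ?gt_eqF//.
rewrite -[LHS]mulrA [RHS]mulrA; congr (_ * _).
  rewrite expr1n mul1r -mulrnAr exprVn sqrtrM ?invr_ge0 ?sqr_ge0//.
  rewrite sqrtrV ?sqr_ge0// sqrtr_sqr gtr0_norm// invfM invrK mulrA mulVf ?mul1r//.
  by rewrite gt_eqF.
rewrite -!expRD; congr expR.
rewrite exprVn vE; field.
by rewrite gt_eqF.
Qed.

(* [expR (t * y ^+ 2)] is the mean of [expR (Num.sqrt (2 * t) * g * y)] for a
   standard normal variable [g]; then exchange the integrals. *)
Lemma gaussian_linearization d (T : measurableType d)
    (P : {sigma_finite_measure set T -> \bar R}) (W Y : T -> R) (c t : R) :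
  (forall x, 0 <= W x) -> measurable_fun setT W -> measurable_fun setT Y ->
  0 <= c -> 0 <= t < 1 / 2 ->
  (forall z, \int[P]_x (W x * expR (z * Y x))%:E = (c * expR (z ^+ 2 / 2))%:E)%E ->
  (\int[P]_x (W x * expR (t * Y x ^+ 2))%:E = (c * (Num.sqrt (1 - 2 * t))^-1)%:E)%E.
Proof.
move=> W0 mW mY c0 ht h; have /andP[t0 t12] := ht.
pose r := Num.sqrt (2 * t).
have rE : r ^+ 2 = 2 * t by rewrite sqr_sqrtr// mulr_ge0.
pose f (z : T * R) := (W z.1 * (normal_pdf 0 1 z.2 * expR (r * Y z.1 * (z.2 - 0))))%:E.
have mf : measurable_fun setT f.
  apply/measurable_EFinP; apply: measurable_funM.
    exact: measurableT_comp mW measurable_fst.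
  apply: measurable_funM.
    exact: measurableT_comp (measurable_normal_pdf 0 1) measurable_snd.
  apply: measurableT_comp (@measurable_expR R) _.
  apply: measurable_funM.
    by apply: measurable_funM => //; exact: measurableT_comp mY measurable_fst.
  by apply: measurable_funB => //; exact: measurable_snd.
have f0 z : (0 <= f z)%E.
  by rewrite lee_fin mulr_ge0// mulr_ge0 ?normal_pdf_ge0 ?expR_ge0.
transitivity (\int[P]_x \int[leb]_y f (x, y))%E.
  apply: eq_integral => x _; rewrite /f/=; under eq_integral do rewrite EFinM.
  rewrite ge0_integralZl//; last 3 first.
  - apply/measurable_EFinP; apply: measurable_funM; first exact: measurable_normal_pdf.
    apply: measurableT_comp (@measurable_expR R) _.
    by apply: measurable_funM => //; apply: measurable_funB.
  - by move=> y _; rewrite lee_fin mulr_ge0 ?normal_pdf_ge0 ?expR_ge0.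
  - by rewrite lee_fin.
  rewrite normal_mgf ?oner_eq0// -EFinM; congr (_ * expR _)%:E.
  by rewrite exprMn rE expr1n; field.
rewrite fubini_tonelli//.
transitivity (\int[leb]_y (c%:E * (normal_pdf 0 1 y * expR (t * y ^+ 2))%:E))%E.
  apply: eq_integral => y _; rewrite /f/=.
  transitivity (\int[P]_x ((normal_pdf 0 1 y)%:E * (W x * expR (r * y * Y x))%:E))%E.
    apply: eq_integral => x _; rewrite -EFinM; congr EFin.
    by rewrite subr0 mulrCA; congr (_ * (_ * expR _)); ring.
  rewrite ge0_integralZl//; last 3 first.
  - apply/measurable_EFinP; apply: measurable_funM => //.
    by apply: measurableT_comp (@measurable_expR R) _; exact: measurable_funM.
  - by move=> x _; rewrite lee_fin mulr_ge0 ?expR_ge0.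
  - by rewrite lee_fin normal_pdf_ge0.
  rewrite h -!EFinM; congr EFin; rewrite mulrCA; congr (_ * (_ * expR _)).
  by rewrite exprMn rE; field.
rewrite ge0_integralZl//; last 2 first.
- apply/measurable_EFinP; apply: measurable_funM; first exact: measurable_normal_pdf.
  apply: measurableT_comp (@measurable_expR R) _.
  by apply: measurable_funM => //; exact: measurable_funX.
- by move=> y _; rewrite lee_fin mulr_ge0 ?normal_pdf_ge0 ?expR_ge0.
by rewrite normal_sq_mgf// -EFinM.
Qed.

(* The variables [Y a] are independent standard normal, expressed through their
   joint moment generating function only. *)
Definition std_gaussian_mgf d (T : measurableType d) (P : probability T R)
    (I : finType) (Y : I -> T -> R) : Prop :=
  forall s : I -> R, (\int[P]_x (expR (\sum_a s a * Y a x))%:E =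
    (expR (\sum_a s a ^+ 2 / 2))%:E)%E.

(** Linear exponents are turned into quadratic ones index by index; [r] lists the indices already
    treated. For a new index [b], the remaining factors form the weight in [gaussian_linearization],
    whose hypothesis is the induction hypothesis with an arbitrary coefficient [z] at [b]. *)
Lemma gaussian_sq_mgf d (T : measurableType d) (P : probability T R)
    (I : finType) (Y : I -> T -> R) (t : I -> R) :
  (forall a, measurable_fun setT (Y a)) -> std_gaussian_mgf P Y ->
  (forall a, 0 <= t a < 1 / 2) ->
  (\int[P]_x (expR (\sum_a t a * Y a x ^+ 2))%:E =
  (\prod_a (Num.sqrt (1 - 2 * t a))^-1)%:E)%E.
Proof.
move=> mY gY ht.
pose F (r : seq I) (s : I -> R) a x :=
  if a \in r then t a * Y a x ^+ 2 else s a * Y a x.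
pose f (r : seq I) (s : I -> R) a :=
  if a \in r then (Num.sqrt (1 - 2 * t a))^-1 else expR (s a ^+ 2 / 2).
have mF r s a : measurable_fun setT (F r s a).
  rewrite /F; case: (a \in r); last exact: measurable_funM.
  by apply: measurable_funM => //; exact: measurable_funX.
suff h (r : seq I) : uniq r -> forall s,
    (\int[P]_x (expR (\sum_a F r s a x))%:E = (\prod_a f r s a)%:E)%E.
  have := h (enum I) (enum_uniq I) (fun=> 0).
  under eq_integral do under eq_bigr do rewrite /F mem_enum.
  by under [in RHS]eq_bigr do rewrite /f mem_enum.
elim: r => [_ s|b r IH /=/andP[br ur] s].
  by rewrite gY expR_sum.
pose W x := expR (\sum_(a | a != b) F (b :: r) s a x).
pose c := \prod_(a | a != b) f (b :: r) s a.
have rb a : a != b -> (a \in b :: r) = (a \in r) by move=> ab; rewrite inE (negbTE ab).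
transitivity (\int[P]_x (W x * expR (t b * Y b x ^+ 2))%:E)%E.
  apply: eq_integral => x _; rewrite /W -expRD (bigD1 b)//= addrC.
  by rewrite [F _ _ b _]/F mem_head.
rewrite (@gaussian_linearization _ _ _ _ _ c)//.
- by congr EFin; rewrite [RHS](bigD1 b)//= mulrC [f _ _ b]/f mem_head.
- by move=> x; exact: expR_ge0.
- apply: measurableT_comp (@measurable_expR R) _.
  under eq_fun do rewrite big_mkcond.
  apply: measurable_sum => a; case: (a != b) => /=; last exact: measurable_cst.
  exact: mF.
- by rewrite /c prodr_ge0// => a _; rewrite /f; case: ifP => _; rewrite ?expR_ge0 ?invr_ge0.
move=> z; pose s' a := if a == b then z else s a.
transitivity (\int[P]_x (expR (\sum_a F r s' a x))%:E)%E.
  apply: eq_integral => x _; rewrite /W -expRD; congr (expR _)%:E.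
  rewrite [RHS](bigD1 b)//= [RHS]addrC; congr (_ + _); last first.
    by rewrite /F (negbTE br) /s' eqxx.
  by apply: eq_bigr => a ab; rewrite /F rb// /s' (negbTE ab).
rewrite IH//; congr EFin; rewrite (bigD1 b)//= mulrC; congr (_ * _).
  by apply: eq_bigr => a ab; rewrite /f rb// /s' (negbTE ab).
by rewrite /f (negbTE br) /s' eqxx.
Qed.

End gaussian_integrals.

(** * Gaussian vectors and their standardized coordinates in an eigenbasis *)

Section gaussian_vectors.
Context {R : realType} d (T : measurableType d) (P : probability T R).

Lemma measurable_linear_form p (a mu : 'cV[R]_p) :
  measurable_fun [set: borel_cV R p]
    (fun x : borel_cV R p => (a^T *m ((x : 'cV[R]_p) - mu)) 0 0).
Proof.
rewrite (_ : (fun _ => _) = (fun x : borel_cV R p =>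
    \sum_i a i 0 * ((x : 'cV[R]_p) i 0 - mu i 0))); last first.
  by apply/funext => x; rewrite mxE; apply: eq_bigr => i _; rewrite !mxE.
apply: measurable_sum => i; apply: measurable_funM => //.
by apply: measurable_funB => //; exact: measurable_coord.
Qed.

Lemma normal_vector_mgf p (mu : 'cV[R]_p) (Sigma : 'M[R]_p) (X : T -> 'cV[R]_p)
    (a : 'cV[R]_p) :
  posdefmx Sigma -> normal_vector P mu Sigma X ->
  (\int[P]_w (expR ((a^T *m (X w - mu)) 0 0))%:E =
  (expR ((a^T *m Sigma *m a) 0 0 / 2))%:E)%E.
Proof.
(* [normal_vector] only describes the combinations with [a != 0]; for [a = 0] both sides equal 1. *)
move=> [_ pd] [mX nX]; have [->|a0] := eqVneq a 0.
  under eq_integral do rewrite trmx0 mul0mx mxE.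
  by rewrite mulmx0 mxE mul0r expR0 integral_cst// mul1e; exact: probability_setT.
pose s := Num.sqrt ((a^T *m Sigma *m a) 0 0).
have q0 := pd a a0.
have s0 : s != 0 by rewrite gt_eqF// sqrtr_gt0.
pose m := (a^T *m mu) 0 0.
have mU : measurable_fun setT (fun w => (a^T *m X w) 0 0).
  have := measurableT_comp (measurable_linear_form a 0) mX.
  by under eq_fun do rewrite /= subr0.
transitivity (\int[P]_w (1 * expR (1 * ((a^T *m X w) 0 0 - m)))%:E)%E.
  by apply: eq_integral => w _; rewrite mulmxBr !mul1r [in LHS]mxE [in X in _ + X]mxE.
pose g (y : R) := expR (1 * (y - m)).
rewrite (@weighted_integral_ext _ _ _ _ _ _ _ _ (@lebesgue_measure R) (cst 1)
  (normal_pdf m s) (fun w => (a^T *m X w) 0 0) (@idfun R) g)//.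
- by rewrite /g normal_mgf// expr1n mul1r sqr_sqrtr// ltW.
- by move=> x; exact: normal_pdf_ge0.
- exact: measurable_normal_pdf.
- exact: measurable_id.
- by move=> x; rewrite /g expR_ge0.
- apply: measurableT_comp (@measurable_expR R) _; apply: measurable_funM => //.
  exact: measurable_funB.
move=> B mB; transitivity (P [set w | B ((a^T *m X w) 0 0)]).
  under eq_integral do rewrite mul1r.
  rewrite integral_indic//=; first by rewrite setIT.
  by rewrite -[X in measurable X]setTI; exact: mU.
rewrite nX// /normal_prob [LHS]integral_mkcond epatch_indic.
by apply: eq_integral => x _.
Qed.

Lemma gaussian_sample_mgf n p (mu : 'cV[R]_p) (Sigma : 'M[R]_p)
    (X : 'I_n -> T -> 'cV[R]_p) (b : 'I_n -> 'cV[R]_p) :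
  posdefmx Sigma -> (forall j, normal_vector P mu Sigma (X j)) ->
  independent_vectors P X ->
  (\int[P]_w (expR (\sum_j ((b j)^T *m (X j w - mu)) 0 0))%:E =
  (expR (\sum_j ((b j)^T *m Sigma *m b j) 0 0 / 2))%:E)%E.
Proof.
move=> pd nX iX.
pose h j (x : borel_cV R p) := expR (((b j)^T *m ((x : 'cV[R]_p) - mu)) 0 0).
have mh j : measurable_fun setT (h j).
  exact: measurableT_comp (@measurable_expR R) (measurable_linear_form _ _).
under eq_integral do rewrite expR_sum.
rewrite expR_sum.
apply: expectation_prod_indep => [j|j x|j|B mB].
- exact: measurableT_comp (mh j) (nX j).1.
- exact: expR_ge0.
- exact: normal_vector_mgf.
have := @iX [set: 'I_n]%SET (fun j => h j @^-1` B j).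
rewrite (eq_bigl xpredT); last by move=> i; rewrite inE.
apply => j _.
by rewrite -[X in measurable X]setTI; exact: mh.
Qed.

Lemma posdef_eigenval_gt0 p (Sigma : 'M[R]_p) (i : 'I_p) :
  posdefmx Sigma -> 0 < eigenval Sigma i.
Proof.
move=> [sS pd]; have [U UU [SE _ _]] := sym_spectral sS.
have e0 : (delta_mx i 0 : 'cV[R]_p) != 0.
  by apply/eqP => /matrixP/(_ i 0); rewrite !mxE !eqxx => /eqP; rewrite oner_eq0.
have v0 : U *m delta_mx i 0 != 0 :> 'cV[R]_p.
  apply: contraNneq e0 => /(congr1 (mulmx U^T)).
  by rewrite mulmxA UU mul1mx mulmx0 => ->.
have := pd _ v0; rewrite {1}SE trmx_mul.
have -> : (delta_mx i 0 : 'cV[R]_p)^T *m U^T *m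
    (U *m diag_mx (\row_i0 eigenval Sigma i0) *m U^T) *m (U *m delta_mx i 0) =
    (delta_mx i 0)^T *m diag_mx (\row_i0 eigenval Sigma i0) *m (delta_mx i 0 : 'cV_p).
  rewrite !mulmxA -(mulmxA _ U^T U) UU mulmx1.
  by rewrite -(mulmxA _ U^T U) UU mulmx1.
rewrite diag_quadratic (bigD1 i)//= big1 => [|j ji]; last first.
  by rewrite [_ j 0]mxE (negbTE ji) expr0n mulr0.
by rewrite !mxE !eqxx expr1n mulr1 addr0.
Qed.

(** The variables Y_ij, indexed by a pair so that the family fits [std_gaussian_mgf]. *)
Definition std_coord n p (mu : 'cV[R]_p) (Sigma U : 'M[R]_p)
    (X : 'I_n -> T -> 'cV[R]_p) (ij : 'I_p * 'I_n) (w : T) : R :=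
  (U^T *m (X ij.2 w - mu)) ij.1 0 / Num.sqrt (eigenval Sigma ij.1).

Lemma std_coord_gaussian n p (mu : 'cV[R]_p) (Sigma U : 'M[R]_p)
    (X : 'I_n -> T -> 'cV[R]_p) :
  posdefmx Sigma -> (forall j, normal_vector P mu Sigma (X j)) ->
  independent_vectors P X ->
  U^T *m U = 1%:M -> Sigma = U *m diag_mx (\row_i eigenval Sigma i) *m U^T ->
  std_gaussian_mgf P (std_coord mu Sigma U X).
Proof.
move=> pd nX iX UU SE s.
(* With this scaling, the sum over [i] of [s (i, j)] times Y_ij is the linear form of [X j w - mu]
   with coefficient vector [U *m c j], whose variance is the sum of the [s (i, j) ^+ 2]. *)
pose c j : 'cV[R]_p := \col_i (s (i, j) / Num.sqrt (eigenval Sigma i)).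
have sqE j : ((U *m c j)^T *m Sigma *m (U *m c j)) 0 0 = \sum_i s (i, j) ^+ 2.
  rewrite trmx_mul {1}SE.
  have -> : (c j)^T *m U^T *m (U *m diag_mx (\row_i eigenval Sigma i) *m U^T) *m (U *m c j)
      = (c j)^T *m diag_mx (\row_i eigenval Sigma i) *m c j.
    rewrite !mulmxA -(mulmxA _ U^T U) UU mulmx1.
    by rewrite -(mulmxA _ U^T U) UU mulmx1.
  rewrite diag_quadratic; apply: eq_bigr => i _; rewrite !mxE.
  have l0 := posdef_eigenval_gt0 i pd.
  rewrite exprMn exprVn sqr_sqrtr ?ltW//; field.
  by rewrite gt_eqF.
transitivity (\int[P]_w (expR (\sum_j ((U *m c j)^T *m (X j w - mu)) 0 0))%:E)%E.
  apply: eq_integral => w _; congr (expR _)%:E.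
  rewrite (eq_bigr (fun ij => s (ij.1, ij.2) * std_coord mu Sigma U X (ij.1, ij.2) w)); last first.
    by case.
  rewrite -(pair_bigA _ (fun i j => s (i, j) * std_coord mu Sigma U X (i, j) w))/=.
  rewrite exchange_big/=; apply: eq_bigr => j _.
  rewrite trmx_mul -mulmxA mxE; apply: eq_bigr => i _.
  by rewrite /std_coord/= ![(c j)^T _ _]mxE [c j _ _]mxE; ring.
rewrite (gaussian_sample_mgf _ pd)//; congr (expR _)%:E.
rewrite (eq_bigr (fun ij => s (ij.1, ij.2) ^+ 2 / 2)); last by case.
rewrite -(pair_bigA _ (fun i j => s (i, j) ^+ 2 / 2))/=.
by rewrite exchange_big/=; apply: eq_bigr => j _; rewrite sqE mulr_suml.
Qed.

Lemma measurable_std_coord n p (mu : 'cV[R]_p) (Sigma U : 'M[R]_p)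
    (X : 'I_n -> T -> 'cV[R]_p) ij :
  (forall j, random_vector (X j)) ->
  measurable_fun setT (std_coord mu Sigma U X ij).
Proof.
move=> mX; apply: measurable_funM => //.
have := measurableT_comp (measurable_linear_form (col ij.1 U) mu) (mX ij.2).
rewrite (_ : _ \o _ = fun w => (U^T *m (X ij.2 w - mu)) ij.1 0)//.
apply/funext => w /=; rewrite !mxE; apply: eq_bigr => i _.
by rewrite !mxE.
Qed.

End gaussian_vectors.

(** * Joint upper tail of sums of squares *)

Section exp_bounds.
Context {R : realType}.
Implicit Types u v x : R.

Lemma expR_ge_sq v : -2 <= v -> (1 + v / 2) ^+ 2 <= expR v.
Proof.
move=> v2; have -> : expR v = expR (v / 2) ^+ 2.
  by rewrite -expRM_natl; congr expR; field.
by rewrite lerXn2r ?nnegrE ?expR_ge0 ?expR_ge1Dx//; lra.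
Qed.

Lemma invsqrt_le v x : 0 < v -> 1 <= v * expR (2 * x) -> (Num.sqrt v)^-1 <= expR x.
Proof.
move=> v0 h; rewrite -[expR x]invrK lef_pV2 ?posrE ?sqrtr_gt0 ?invr_gt0 ?expR_gt0//.
rewrite -(@ler_pXn2r _ 2)// ?nnegrE ?invr_ge0 ?expR_ge0 ?sqrtr_ge0//.
rewrite sqr_sqrtr; last exact: ltW.
rewrite exprVn -expRM_natl.
by rewrite -[_^-1]mul1r ler_pdivrMr ?expR_gt0.
Qed.

Lemma invsqrt_ge v x : 0 < v -> v * expR (2 * x) <= 1 -> expR x <= (Num.sqrt v)^-1.
Proof.
move=> v0 h; rewrite -[expR x]invrK lef_pV2 ?posrE ?sqrtr_gt0 ?invr_gt0 ?expR_gt0//.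
rewrite -(@ler_pXn2r _ 2)// ?nnegrE ?invr_ge0 ?expR_ge0 ?sqrtr_ge0//.
rewrite sqr_sqrtr; last exact: ltW.
rewrite exprVn -expRM_natl.
by rewrite -[_^-1]mul1r ler_pdivlMr ?expR_gt0.
Qed.

(** The term [u / 2] is the exact first order of the logarithm; it will cancel the centering by [n]
    in [exp_moment]. The true second-order coefficient is 1/4, which the coefficients 1/2 here and
    1/8 in [invsqrt_lb] enclose. *)
Lemma invsqrt_ub u : 0 <= u <= 1 / 4 ->
  (Num.sqrt (1 - u))^-1 <= expR (u / 2 + u ^+ 2 / 2).
Proof.
move=> /andP[u0 u4]; apply: invsqrt_le; first lra.
have : (1 + (u + u ^+ 2) / 2) ^+ 2 <= expR (u + u ^+ 2) by apply: expR_ge_sq; nra.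
rewrite (_ : 2 * _ = u + u ^+ 2); last by field.
move=> h; apply: (@le_trans _ _ ((1 - u) * (1 + (u + u ^+ 2) / 2) ^+ 2)); last first.
  by rewrite ler_wpM2l//; lra.
(* The bracket is nonnegative because [u <= 1 / 4]. *)
rewrite (_ : (1 - u) * _ = 1 + u ^+ 2 * ((1 - u) * (1 + u) ^+ 2 / 4 - u)); last by field.
rewrite lerDl mulr_ge0 ?sqr_ge0//; nra.
Qed.

Lemma invsqrt_lb u : 0 <= u <= 1 / 4 ->
  expR (u / 2 + u ^+ 2 / 8) <= (Num.sqrt (1 - u))^-1.
Proof.
move=> /andP[u0 u4]; apply: invsqrt_ge; first lra.
rewrite (_ : 2 * _ = - - (u + u ^+ 2 / 4)); last by field.
rewrite expRN ler_pdivrMr ?expR_gt0// mul1r.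
apply: le_trans (expR_ge_sq _); last nra.
rewrite (_ : (1 + - (u + u ^+ 2 / 4) / 2) ^+ 2 =
  1 - u - u ^+ 2 / 4 + (u + u ^+ 2 / 4) ^+ 2 / 4); last by field.
nra.
Qed.
End exp_bounds.

(** * The polynomial test function and its mean *)

Section tilted_test_function.
Context {R : realType}.
Variable C : R.
Hypothesis C0 : 0 < C.

(* For [z = expR (C * (Q - n) / Num.sqrt n)], the bound [Q <= n + C * Num.sqrt n]
   means [z ^+ 2 <= A]. The test function [1 + e * z * (z ^+ 2 - A) * (z ^+ 2 - B)]
   has mean below 1 because [E z ^+ 3] exceeds [A * E z] by a definite amount;
   [B] is chosen large to absorb [E z ^+ 5 <= K5], and [e] small for positivity. *)
Let A := expR (2 * C ^+ 2).
Let K3 := expR (18 * C ^+ 2).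
Let K5 := expR (50 * C ^+ 2).
Let B := A + (K5 + 1) / (expR (9 / 2 * C ^+ 2) - expR (4 * C ^+ 2)).
(** This is both the coefficient [e] and the gained eps. The normalization
    [e * (B ^+ 3 * K3) = 1 / 2] yields the nonnegativity of the test function and of its mean. *)
Definition tail_gap := (2 * B ^+ 3 * K3)^-1.
Let e := tail_gap.
Definition test_coef (l : 'I_4) : R := [:: 1; e * A * B; - (e * (A + B)); e]`_l.
Definition test_exponent (l : 'I_4) : nat := nth 0%N [:: 0; 1; 3; 5]%N l.
Definition test_fun (z : R) := \sum_l test_coef l * z ^+ test_exponent l.

Let C20 : 0 < C ^+ 2. Proof. by rewrite exprn_gt0. Qed.
Let gap0 : 0 < expR (9 / 2 * C ^+ 2) - expR (4 * C ^+ 2).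
Proof. by rewrite subr_gt0 ltr_expR; have := C20; lra. Qed.
Let A1 : 1 <= A. Proof. by rewrite (le_trans _ (expR_ge1Dx _))// lerDl mulr_ge0// ltW. Qed.
Let K31 : 1 <= K3. Proof. by rewrite (le_trans _ (expR_ge1Dx _))// lerDl mulr_ge0// ltW. Qed.
Let K50 : 0 < K5. Proof. exact: expR_gt0. Qed.
Let BA : A <= B. Proof.
by rewrite lerDl; apply: divr_ge0; [apply: addr_ge0 => //|]; exact: ltW.
Qed.
Let B1 : 1 <= B. Proof. exact: le_trans BA. Qed.
Let B31 : 1 <= B ^+ 3. Proof. by rewrite exprn_ege1. Qed.
Let BK : 1 <= B ^+ 3 * K3. Proof. by rewrite -[1]mul1r ler_pM. Qed.
Let e0 : 0 < e. Proof.
rewrite /e /tail_gap invr_gt0 -(mulrA 2) mulr_gt0//; exact: lt_le_trans BK.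
Qed.
Let e0' : 0 <= e. Proof. exact: ltW. Qed.
Let eBK : e * (B ^+ 3 * K3) = 1 / 2.
Proof.
rewrite /e /tail_gap; field.
by rewrite !gt_eqF// -?mulr_gt0 ?(lt_le_trans ltr01).
Qed.

Lemma tail_gapP : 0 < tail_gap <= 1 / 2.
Proof. by rewrite -/e e0/= -eBK; have := BK; have := e0; nra. Qed.

Lemma test_funE z : test_fun z = 1 + e * z * (z ^+ 2 - A) * (z ^+ 2 - B).
Proof.
rewrite /test_fun /test_coef /test_exponent !big_ord_recl big_ord0/=.
rewrite /bump/=; ring.
Qed.

(** Since [A <= B], both factors [z ^+ 2 - A] and [z ^+ 2 - B] are nonpositive. *)
Lemma test_fun_ge1 z : 0 <= z -> z ^+ 2 <= A -> 1 <= test_fun z.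
Proof.
move=> z0 zA; rewrite test_funE lerDl -mulrA mulr_ge0//; first by rewrite mulr_ge0// ltW.
by rewrite -mulrNN mulr_ge0//; have := BA; lra.
Qed.

(** The added term can be negative only when [z ^+ 2] lies between [A] and [B]; there [z <= B], so
    its size is at most [e * B ^+ 3], hence at most 1. *)
Lemma test_fun_ge0 z : 0 <= z -> 0 <= test_fun z.
Proof.
move=> z0; have [zA|zA] := leP (z ^+ 2) A.
  by rewrite (le_trans _ (test_fun_ge1 z0 zA)).
rewrite test_funE; have [zB|zB] := leP (z ^+ 2) B; last first.
  rewrite addr_ge0// mulr_ge0//; last by rewrite subr_ge0 ltW.
  by rewrite !mulr_ge0 ?subr_ge0// ltW.
have zB' : z <= B.
  have [z1|z1] := leP z 1; first exact: le_trans B1.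
  by apply: le_trans zB; rewrite expr2 ler_peMl// ltW.
have h : z * ((z ^+ 2 - A) * (B - z ^+ 2)) <= B ^+ 3.
  have zA' := ltW zA.
  have -> : B ^+ 3 = B * (B * B) by ring.
  apply: ler_pM => //; first by rewrite mulr_ge0 ?subr_ge0.
  by apply: ler_pM; rewrite ?subr_ge0//; have := A1; have := sqr_ge0 z; lra.
have h2 : e * (z * ((z ^+ 2 - A) * (B - z ^+ 2))) <= 1.
  apply: (@le_trans _ _ (e * (B ^+ 3 * K3))); last by rewrite eBK; lra.
  rewrite ler_wpM2l//; apply: le_trans h _.
  rewrite ler_peMr//; exact: le_trans B31.
rewrite (_ : e * z * _ * _ = - (e * (z * ((z ^+ 2 - A) * (B - z ^+ 2))))); last by ring.
by rewrite subr_ge0.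
Qed.

(** The mean is affine in the moments. The choice of [B] makes the third moment term exceed the
    first moment term by at least [K5 + 1], which leaves at most [- e] after adding the fifth
    moment. The lower bound 0 allows raising the estimate to a power later. *)
Lemma test_expectation (M : nat -> R) :
  M 0%N = 1 -> 0 <= M 1%N <= expR (2 * C ^+ 2) ->
  expR (9 / 2 * C ^+ 2) <= M 3%N <= K3 -> 0 <= M 5%N <= K5 ->
  0 <= \sum_l test_coef l * M (test_exponent l) <= 1 - tail_gap.
Proof.
move=> M0 /andP[M10 M1] /andP[M3l M3u] /andP[M50 M5].
rewrite /test_coef /test_exponent !big_ord_recl big_ord0 /bump/= M0 -/e.
have M30 : 0 <= M 3%N by rewrite (le_trans _ M3l)// expR_ge0.
apply/andP; split.
  have h : e * (A + B) * M 3%N <= 1.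
    apply: (@le_trans _ _ (2 * (e * (B ^+ 3 * K3)))); last by rewrite eBK; lra.
    rewrite mulrCA -mulrA ler_wpM2l// mulrA ler_pM//.
      by rewrite addr_ge0//; [exact: le_trans A1|exact: le_trans B1].
    rewrite (_ : B ^+ 3 = B * (B * B)); last by ring.
    by have := BA; have := B1; nra.
  have h1 : 0 <= e * A * B * M 1%N.
    by rewrite !mulr_ge0//; [exact: le_trans A1|exact: le_trans B1].
  have h5 : 0 <= e * M 5%N by rewrite mulr_ge0.
  lra.
have h1 : A * B * M 1%N <= B * expR (4 * C ^+ 2).
  rewrite mulrAC mulrC ler_wpM2l//; first exact: le_trans B1.
  rewrite (_ : expR (4 * C ^+ 2) = A * expR (2 * C ^+ 2)); last first.
    by rewrite -expRD; congr expR; ring.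
  by rewrite ler_wpM2l// expR_ge0.
have h3 : B * expR (9 / 2 * C ^+ 2) <= (A + B) * M 3%N.
  rewrite ler_pM ?expR_ge0//; first exact: le_trans B1.
  by rewrite lerDr expR_ge0.
have hB : K5 + 1 <= B * (expR (9 / 2 * C ^+ 2) - expR (4 * C ^+ 2)).
  rewrite /B mulrDl divfK ?gt_eqF// lerDr mulr_ge0// ?expR_ge0//; exact: ltW.
have : e * (M 5%N - (A + B) * M 3%N + A * B * M 1%N) <= e * (-1).
  by rewrite ler_wpM2l//; lra.
lra.
Qed.

End tilted_test_function.

Section measurable_half_lines.
Context {R : realType} d (T : measurableType d).

Lemma measurable_set_le (f : T -> R) (c : R) :
  measurable_fun setT f -> measurable [set w | f w <= c].
Proof.
move=> mf; rewrite (_ : [set w | _] = setT `&` f @^-1` `]-oo, c]%classic); first exact: mf.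
by apply/seteqP; split => w /=; rewrite in_itv/= => // -[].
Qed.

Lemma measurable_set_gt (f : T -> R) (c : R) :
  measurable_fun setT f -> measurable [set w | c < f w].
Proof.
move=> mf; rewrite (_ : [set w | _] = ~` [set w | f w <= c]).
  by apply: measurableC; exact: measurable_set_le.
by apply/seteqP; split => w /=; rewrite ltNge => /negP.
Qed.

End measurable_half_lines.

Lemma prodr_constT (R : pzSemiRingType) (I : finType) (x : R) :
  \prod_(i : I) x = x ^+ #|I|.
Proof. by rewrite -prodr_const; apply: eq_bigl. Qed.

(** * Moments of the tilted variables and the joint tail bound *)

Section joint_tail.
Context {R : realType}.
Variable C : R.
Hypothesis C0 : 0 < C.
Variable n : nat.
Hypothesis nC : 40 * C <= Num.sqrt n%:R.
Let r : R := Num.sqrt n%:R.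

Let r0 : 0 < r. Proof. by apply: lt_le_trans nC; rewrite mulr_gt0. Qed.
Let rn : r ^+ 2 = n%:R. Proof. by rewrite sqr_sqrtr. Qed.

(** The moment E z^m of z = exp (C (Q - n) / sqrt n) for Q chi-square with [n] degrees of
    freedom. *)
Definition exp_moment (m : nat) : R :=
  expR (- (m%:R * C * r)) * (Num.sqrt (1 - 2 * (m%:R * C / r)))^-1 ^+ n.

(** For exponents up to 5 the argument is at most [10 * C / r]; the constant 40 in [nC] brings it
    below 1/4. *)
Let u_bnd (m : nat) : (m <= 5)%N -> 0 <= 2 * (m%:R * C / r) <= 1 / 4.
Proof.
move=> m5; have m5' : m%:R <= 5 :> R by rewrite ler_nat.
have m0 : 0 <= m%:R :> R by [].
apply/andP; split; first by rewrite !mulr_ge0// ?invr_ge0 ltW.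
rewrite mulrA ler_pdivrMr//; have := nC; rewrite -/r => h.
by have := C0; nra.
Qed.

(** With u = 2 m C / r, the power [n] turns u / 2 into m C r, which cancels the prefactor, and turns
    u^2 / 8 and u^2 / 2 into quantities free of [n]. *)
Lemma exp_moment_bounds (m : nat) : (m <= 5)%N ->
  expR (m%:R ^+ 2 * C ^+ 2 / 2) <= exp_moment m <= expR (2 * m%:R ^+ 2 * C ^+ 2).
Proof.
move=> /u_bnd hu; rewrite /exp_moment; set u := 2 * _ in hu *.
have uE : u = 2 * (m%:R * C / r) by [].
have rn0 : r != 0 by rewrite gt_eqF.
apply/andP; split.
  apply: (@le_trans _ _ (expR (- (m%:R * C * r)) * expR (u / 2 + u ^+ 2 / 8) ^+ n)).
    rewrite -expRM_natl -expRD ler_expR -rn uE.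
    by rewrite le_eqVlt; apply/orP; left; apply/eqP; field.
  rewrite ler_wpM2l ?expR_ge0// lerXn2r ?nnegrE ?expR_ge0 ?invr_ge0 ?sqrtr_ge0//.
  exact: invsqrt_lb.
apply: (@le_trans _ _ (expR (- (m%:R * C * r)) * expR (u / 2 + u ^+ 2 / 2) ^+ n)).
  rewrite ler_wpM2l ?expR_ge0// lerXn2r ?nnegrE ?expR_ge0 ?invr_ge0 ?sqrtr_ge0//.
  exact: invsqrt_ub.
rewrite -expRM_natl -expRD ler_expR -rn uE.
by rewrite le_eqVlt; apply/orP; left; apply/eqP; field.
Qed.

Lemma exp_moment0 : exp_moment 0 = 1.
Proof. by rewrite /exp_moment !mul0r oppr0 expR0 mulr0 subr0 sqrtr1 invr1 expr1n mulr1. Qed.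

Lemma test_expectation_exp_moment :
  0 <= \sum_l test_coef C l * exp_moment (test_exponent l) <= 1 - tail_gap C.
Proof.
have eq_e (x y z : R) : x = y -> expR x <= z -> expR y <= z by move=> ->.
have eq_e' (x y z : R) : x = y -> z <= expR x -> z <= expR y by move=> ->.
have h1 := exp_moment_bounds (isT : (1 <= 5)%N).
have h3 := exp_moment_bounds (isT : (3 <= 5)%N).
have h5 := exp_moment_bounds (isT : (5 <= 5)%N).
apply: (test_expectation C0); first exact: exp_moment0.
- have /andP[a b] := h1; rewrite (le_trans (expR_ge0 _) a)/=.
  by move: b; apply: eq_e'; ring.
- have /andP[a b] := h3; apply/andP; split.
  + by move: a; apply: eq_e; field.
  + by move: b; apply: eq_e'; ring.
- have /andP[a b] := h5; rewrite (le_trans (expR_ge0 _) a)/=.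
  by move: b; apply: eq_e'; ring.
Qed.

Context d (T : measurableType d) (P : probability T R).
Context (I : finType) (Y : I * 'I_n -> T -> R).
Hypothesis mY : forall a, measurable_fun setT (Y a).
Hypothesis gY : std_gaussian_mgf P Y.

Definition sumsq i w : R := \sum_j Y (i, j) w ^+ 2.
Let z i w := expR (C * (sumsq i w - n%:R) / r).

Lemma measurable_sumsq i : measurable_fun setT (sumsq i).
Proof.
by apply: measurable_sum => j; exact: measurable_funX.
Qed.

Let mz i : measurable_fun setT (z i).
Proof.
apply: measurableT_comp (@measurable_expR R) _; apply: measurable_funM => //.
apply: measurable_funM => //; apply: measurable_funB => //.
exact: measurable_sumsq.
Qed.

(** The product is a constant [k] times the exponential of a nonnegative combination of squares, so
    [gaussian_sq_mgf] factors its mean over [i]. *)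
Let expectation_prod_tilt (h : I -> nat) : (forall i, h i <= 5)%N ->
  (\int[P]_w (\prod_i z i w ^+ h i)%:E = (\prod_i exp_moment (h i))%:E)%E.
Proof.
move=> h5; pose t (a : I * 'I_n) := (h a.1)%:R * C / r.
have rn0 : r != 0 by rewrite gt_eqF.
have ht a : 0 <= t a < 1 / 2.
  by have := u_bnd (h5 a.1); rewrite -/(t a) => /andP[? ?]; apply/andP; split; lra.
pose k := expR (\sum_i - ((h i)%:R * C * r)).
transitivity (\int[P]_w (k%:E * (expR (\sum_a t a * Y a w ^+ 2))%:E))%E.
  apply: eq_integral => w _; rewrite -EFinM -expRD; congr EFin.
  under eq_bigr do rewrite /z -expRM_natl.
  rewrite -expR_sum; congr expR.
  rewrite (eq_bigr (fun a => t (a.1, a.2) * Y (a.1, a.2) w ^+ 2)); last by case.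
  rewrite -(pair_bigA _ (fun i j => t (i, j) * Y (i, j) w ^+ 2))/= -big_split/=.
  apply: eq_bigr => i _; rewrite /t/= -mulr_sumr -/(sumsq i w) -rn.
  by field.
rewrite ge0_integralZl//; last 2 first.
- apply/measurable_EFinP; apply: measurableT_comp (@measurable_expR R) _.
  by apply: measurable_sum => a; apply: measurable_funM => //; exact: measurable_funX.
- by rewrite lee_fin expR_ge0.
rewrite gaussian_sq_mgf// -EFinM; congr EFin.
rewrite /k expR_sum (eq_bigr (fun a => (Num.sqrt (1 - 2 * t (a.1, a.2)))^-1)); last by case.
rewrite -(pair_bigA _ (fun i j => (Num.sqrt (1 - 2 * t (i, j)))^-1))/= -big_split/=.
by apply: eq_bigr => i _; rewrite /t/= prodr_constT card_ord.
Qed.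

Let exponent_le5 l : (test_exponent l <= 5)%N.
Proof. by case: l => -[|[|[|[|]]]]. Qed.

(** Expand the product of sums into monomials indexed by maps [h], integrate each, and refold by
    distributivity: factoring the moments is enough to factor the mean. *)
Let expectation_prod_test :
  (\int[P]_w (\prod_i test_fun C (z i w))%:E =
  (\prod_(i : I) \sum_l test_coef C l * exp_moment (test_exponent l))%:E)%E.
Proof.
pose c (h : {ffun I -> 'I_4}) := \prod_i test_coef C (h i).
pose g (h : {ffun I -> 'I_4}) w := \prod_i z i w ^+ test_exponent (h i).
have Eg h : (\int[P]_w (g h w)%:E = (\prod_i exp_moment (test_exponent (h i)))%:E)%E.
  exact: expectation_prod_tilt.
have ig h : P.-integrable setT (fun w => (g h w)%:E).
  apply/integrableP; split.
    apply/measurable_EFinP; apply: measurable_prod => i _.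
    exact: measurable_funX.
  rewrite (eq_integral (fun w => (g h w)%:E)) ?Eg ?ltry// => w _.
  by rewrite gee0_abs// lee_fin prodr_ge0// => i _; rewrite exprn_ge0// expR_ge0.
transitivity (\int[P]_w \sum_h ((c h)%:E * (g h w)%:E))%E.
  apply: eq_integral => w _; rewrite /test_fun bigA_distr_bigA/= -sumEFin.
  by apply: eq_bigr => h _; rewrite big_split EFinM.
rewrite integral_sum//; last by move=> h; exact: integrableZl.
rewrite bigA_distr_bigA/= -sumEFin; apply: eq_bigr => h _.
rewrite integralZl//.
by rewrite Eg -EFinM; congr EFin; rewrite [RHS]big_split.
Qed.

(** The indicator of the event is bounded by the product of the test functions: each factor is
    nonnegative everywhere and at least 1 on the event. *)
Lemma joint_sumsq_tail :
  (P (\bigcap_i [set w | (sumsq i w <= n%:R + C * r)%R]) <=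
  ((1 - tail_gap C) ^+ #|I|)%:E)%E.
Proof.
set E := \bigcap_i _.
have mE : measurable E.
  apply: fin_bigcap_measurable => [|i _]; first exact: finite_finset.
  apply: measurable_set_le; exact: measurable_sumsq.
have z0 i w : 0 <= z i w by exact: expR_ge0.
apply: (@le_trans _ _ (\int[P]_w (\prod_i test_fun C (z i w))%:E)%E).
  have -> : P E = (\int[P]_w (\1_E w)%:E)%E by rewrite integral_indic// setIT.
  apply: ge0_le_integral => //.
  - exact/measurable_EFinP/measurable_indic.
  - apply/measurable_EFinP; apply: measurable_prod => i _.
    apply: measurable_sum => l; apply: measurable_funM => //.
    exact: measurable_funX.
  - move=> w _; rewrite lee_fin indicE; case: (boolP (w \in E)) => [/set_mem Ew|_]; last first.
      by rewrite prodr_ge0// => i _; exact: test_fun_ge0.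
    apply: (big_ind (fun x : R => 1 <= x)) => //= [x y x1 y1|i _].
      by rewrite -[1]mul1r ler_pM.
    apply: test_fun_ge1 => //; rewrite /z -expRM_natl ler_expR.
    have := Ew i Logic.I; rewrite /= => hq.
    have : (sumsq i w - n%:R) / r <= C by rewrite ler_pdivrMr// lerBlDl.
    rewrite -mulrA expr2 => h; rewrite ler_wpM2l// ler_wpM2l// ltW//.
rewrite expectation_prod_test lee_fin prodr_constT.
have /andP[a b] := test_expectation_exp_moment.
by rewrite lerXn2r// nnegrE// (le_trans a).
Qed.
End joint_tail.

(** * Largest eigenvalue of the sample covariance matrix *)

Section sample_covariance.
Context {R : realType}.

Lemma quad_sample_cov n p (x : 'I_n -> 'cV[R]_p) (v : 'cV[R]_p) :
  (v^T *m sample_cov x *m v) 0 0 =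
  n%:R^-1 * \sum_j ((v^T *m (x j - sample_mean x)) 0 0) ^+ 2.
Proof.
rewrite /sample_cov -scalemxAr -scalemxAl mxE; congr (_ * _).
rewrite mulmx_sumr mulmx_suml summxE; apply: eq_bigr => j _.
set y := x j - _.
have -> : v^T *m (y *m y^T) *m v = (v^T *m y) *m (v^T *m y)^T.
  by rewrite trmx_mul trmxK !mulmxA.
by rewrite mxE big_ord1 [in X in _ * X]mxE expr2.
Qed.

Lemma sample_cov_sym n p (x : 'I_n -> 'cV[R]_p) : (sample_cov x)^T = sample_cov x.
Proof.
rewrite /sample_cov linearZ/= raddf_sum/=; congr (_ *: _).
by apply: eq_bigr => j _; rewrite trmx_mul trmxK.
Qed.

Lemma centered_sumsq n (y : 'I_n -> R) : (0 < n)%N ->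
  \sum_j (y j - n%:R^-1 * \sum_k y k) ^+ 2 =
  \sum_j y j ^+ 2 - (\sum_k y k) ^+ 2 / n%:R.
Proof.
move=> n0; have n0' : n%:R != 0 :> R by rewrite pnatr_eq0 -lt0n.
set s := \sum_k y k.
under eq_bigr => j _ do rewrite sqrrB -addrA.
rewrite big_split big_split/= sumr_const card_ord -[_ ^+ 2 *+ n]mulr_natr.
rewrite (_ : \sum_i - _ = - (2 * (n%:R^-1 * s) * s)).
  by field.
rewrite sumrN; congr (- _).
transitivity (2 * (n%:R^-1 * s) * \sum_k y k) => //.
rewrite [RHS]mulr_sumr; apply: eq_bigr => j _.
by ring.
Qed.

Lemma eigenval0_leP_gt0 p (A : 'M[R]_p) (lam : R) : (0 < p)%N -> A^T = A ->
  eigenval A 0 <= lam <->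
  forall v : 'cV[R]_p, (v^T *m A *m v) 0 0 <= lam * (v^T *m v) 0 0.
Proof. by case: p A => // p A _; exact: eigenval0_leP. Qed.

Lemma quadratic_expand p (B : 'M[R]_p) (v : 'cV[R]_p) :
  (v^T *m B *m v) 0 0 = \sum_i \sum_j v j 0 * B j i * v i 0.
Proof.
rewrite mxE; apply: eq_bigr => i _; rewrite mxE mulr_suml.
by apply: eq_bigr => j _; rewrite mxE.
Qed.

Lemma continuous_sum (V : topologicalType) I (s : seq I) (F : I -> V -> R) :
  (forall i, continuous (F i)) -> continuous (fun x => \sum_(i <- s) F i x).
Proof.
move=> cF; elim: s => [|i s IH] x.
  by under eq_fun do rewrite big_nil; exact: cvg_cst.
under eq_fun do rewrite big_cons.
by apply: cvgD; [exact: cF|exact: IH].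
Qed.

Lemma quadratic_continuous p (B : 'M[R]_p) :
  continuous (fun v : 'cV[R]_p => (v^T *m B *m v) 0 0).
Proof.
under eq_fun do rewrite quadratic_expand.
apply: continuous_sum => i; apply: continuous_sum => j v.
have c k : (fun v : 'cV[R]_p => v k 0) x @[x --> v] --> v k 0.
  exact: coord_continuous.
exact: (cvgM (cvgM (c j) (cvg_cst (B j i))) (c i)).
Qed.

(** A positive value at [v] would persist, by continuity, on a ball around [v], which contains a
    rational vector. *)
Lemma quadratic_le0_rat p (B : 'M[R]_p) :
  (forall u : 'cV[rat]_p, ((map_mx ratr u)^T *m B *m map_mx ratr u) 0 0 <= 0) ->
  forall v : 'cV[R]_p, (v^T *m B *m v) 0 0 <= 0.
Proof.
move=> hu v; rewrite leNgt; apply/negP => v0.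
have /= := @quadratic_continuous p B v.
move=> /(_ `]0, +oo[%classic) /=.
have no : nbhs ((v^T *m B *m v) 0 0) `]0, +oo[%classic.
  by apply: open_nbhs_nbhs; split; [exact: interval_open|rewrite /= in_itv/= v0].
move=> /(_ no) /nbhs_ballP[e /= e0 he].
have hr i : exists u : rat, `|v i 0 - ratr u| < e.
  have [u] := @rat_in_itvoo R (v i 0 - e) (v i 0 + e) ltac:(lra).
  by rewrite in_itv/= => /andP[u1 u2]; exists u; rewrite ltr_norml; lra.
have [u uE] := choice hr.
pose w : 'cV[rat]_p := \col_i u i.
have : ball v e (map_mx ratr w).
  by split => // i j; rewrite !mxE ord1; exact: uE.
move=> /he /=; rewrite in_itv/= andbT ltNge.
by rewrite hu.
Qed.

(** By Rayleigh's principle and density, the event is an intersection over rational test vectors of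
    half-line conditions on measurable quadratic forms. The index [k] enumerates these vectors, and
    codes of no vector contribute [setT]. *)
Lemma measurable_eigenval0_le d (T : measurableType d) n p
    (X : 'I_n -> T -> 'cV[R]_p) (lam : R) :
  (0 < p)%N -> (forall j, random_vector (X j)) ->
  measurable [set w | eigenval (sample_cov (fun j => X j w)) 0 <= lam].
Proof.
move=> p0 mX.
pose f (v : 'cV[R]_p) w := (v^T *m sample_cov (fun j => X j w) *m v) 0 0.
have mf v : measurable_fun setT (f v).
  rewrite /f; under eq_fun do rewrite quad_sample_cov.
  apply: measurable_funM => //; apply: measurable_sum => j; apply: measurable_funX.
  under eq_fun do rewrite mxE.
  apply: measurable_sum => i; apply: measurable_funM => //.
  under eq_fun do rewrite mxE [in X in _ + X]mxE /sample_mean mxE summxE.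
  apply: measurable_funB; first exact: random_vector_coord.
  by apply: measurable_funM => //; apply: measurable_sum => k; exact: random_vector_coord.
pose E (u : 'cV[rat]_p) := let v := map_mx ratr u in
  f v @^-1` `]-oo, lam * (v^T *m v) 0 0]%classic.
have mE u : measurable (E u) by rewrite -[E u]setTI; exact: mf.
rewrite (_ : [set w | _] = \bigcap_(k : nat) (if unpickle k is Some u then E u else setT)).
  by apply: bigcap_measurableType => k _; case: unpickle.
apply/seteqP; split => w /=.
  move=> /(eigenval0_leP_gt0 _ p0 (sample_cov_sym _)) h k _.
  by case: unpickle => // u; rewrite /E/= in_itv/=; exact: h.
move=> h; apply/(eigenval0_leP_gt0 _ p0 (sample_cov_sym _)) => v.
pose B := sample_cov (fun j => X j w) - lam%:M.
have BE v' : (v'^T *m B *m v') 0 0 = f v' w - lam * (v'^T *m v') 0 0.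
  by rewrite /B mulmxBr mulmxBl mul_mx_scalar -scalemxAl mxE [in X in _ + X]mxE [in X in _ - X]mxE.
rewrite -subr_le0 -BE; apply: quadratic_le0_rat => u; rewrite BE subr_le0.
have := h (pickle u) Logic.I; rewrite pickleK.
by rewrite /E/= in_itv.
Qed.

End sample_covariance.

(** * Subfamilies of a standard Gaussian family and tails of their sums *)

Section std_gaussian.
Context {R : realType} d (T : measurableType d) (P : probability T R).

(** Coefficients on the subfamily are extended by zero; by injectivity each fibre sum [s' a] has at
    most one term. *)
Lemma std_gaussian_mgf_sub (I K : finType) (Y : I -> T -> R) (g : K -> I) :
  injective g -> std_gaussian_mgf P Y -> std_gaussian_mgf P (Y \o g).
Proof.
move=> gI gY s; pose s' a := \sum_(b | g b == a) s b.
have s'E b : s' (g b) = s b.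
  rewrite /s' (eq_bigl (pred1 b)) ?big_pred1_eq// => b'.
  by rewrite (inj_eq gI).
have key (F : I -> R) : \sum_a s' a * F a = \sum_b s b * F (g b).
  under eq_bigr do rewrite mulr_suml big_mkcond.
  rewrite exchange_big/=; apply: eq_bigr => b _.
  by rewrite -big_mkcond/= (big_pred1 (g b)).
transitivity (\int[P]_w (expR (\sum_a s' a * Y a w))%:E)%E.
  by apply: eq_integral => w _; rewrite key.
rewrite gY; congr (expR _)%:E.
under eq_bigr do rewrite expr2 -mulrA.
rewrite key; apply: eq_bigr => b _.
by rewrite s'E expr2 mulrA.
Qed.

(** Outside this event, the correction to the sum of squares caused by the sample mean,
    [(\sum_j Y (i, j) w) ^+ 2 / n%:R], is at most sqrt n. *)
Lemma sum_tail (I : finType) n (Y : I * 'I_n -> T -> R) (i : I) :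
  (forall a, measurable_fun setT (Y a)) -> std_gaussian_mgf P Y -> (0 < n)%N ->
  (P [set w | (n%:R * Num.sqrt n%:R < (\sum_j Y (i, j) w) ^+ 2)%R] <=
  (2 * expR (- (Num.sqrt n%:R / 2)))%:E)%E.
Proof.
move=> mY gY n0; set r := Num.sqrt n%:R.
have r0 : 0 < r by rewrite sqrtr_gt0 ltr0n.
have rn : r ^+ 2 = n%:R by rewrite sqr_sqrtr.
(* Chernoff bound with exponents [h^-1] and [- h^-1], where [h = n^(1/4)]. *)
pose h := Num.sqrt r.
have h0 : 0 < h by rewrite sqrtr_gt0.
have hr : h ^+ 2 = r by rewrite sqr_sqrtr// ltW.
pose S w := \sum_j Y (i, j) w.
have mS : measurable_fun setT S by exact: measurable_sum.
set E := [set w | _].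
have mE : measurable E.
  rewrite (_ : E = setT `&` (fun w => S w ^+ 2) @^-1` `]n%:R * r, +oo[%classic); last first.
    by apply/seteqP; split => w /=; rewrite in_itv/= andbT => // -[].
  by apply: measurable_funX.
have ES a : (\int[P]_w (expR (a * S w))%:E = (expR (n%:R * (a ^+ 2 / 2)))%:E)%E.
  pose s (b : I * 'I_n) := if b.1 == i then a else 0.
  transitivity (\int[P]_w (expR (\sum_b s b * Y b w))%:E)%E.
    apply: eq_integral => w _; congr (expR _)%:E.
    rewrite (eq_bigr (fun b => s (b.1, b.2) * Y (b.1, b.2) w)); last by case.
    rewrite -(pair_bigA _ (fun k j => s (k, j) * Y (k, j) w))/= (bigD1 i)//=.
    rewrite [X in _ + X]big1 ?addr0; last first.
      by move=> k ki; rewrite big1// => j _; rewrite /s/= (negbTE ki) mul0r.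
    by rewrite /S mulr_sumr; apply: eq_bigr => j _; rewrite /s/= eqxx.
  rewrite gY; congr (expR _)%:E.
  rewrite (eq_bigr (fun b => s (b.1, b.2) ^+ 2 / 2)); last by case.
  rewrite -(pair_bigA _ (fun k j => s (k, j) ^+ 2 / 2))/= (bigD1 i)//=.
  rewrite [X in _ + X]big1 ?addr0; last first.
    by move=> k ki; rewrite big1// => j _; rewrite /s/= (negbTE ki) expr0n mul0r.
  rewrite /s/= eqxx sumr_const card_ord -[LHS]mulr_natl.
  by [].
have mexp a : measurable_fun setT (fun w => (expR (a * S w))%:E).
  apply/measurable_EFinP; apply: measurableT_comp (@measurable_expR R) _.
  exact: measurable_funM.
have bnd a : n%:R * (a ^+ 2 / 2) = r / 2 ->
    (\int[P]_w ((expR (- r))%:E * (expR (a * S w))%:E) = (expR (- (r / 2)))%:E)%E.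
  move=> ha; rewrite ge0_integralZl//.
  rewrite ES -EFinM -expRD ha; congr (expR _)%:E; lra.
have -> : P E = (\int[P]_w (\1_E w)%:E)%E by rewrite integral_indic// setIT.
apply: (@le_trans _ _ (\int[P]_w ((expR (- r))%:E * (expR (h^-1 * S w))%:E +
    (expR (- r))%:E * (expR (- h^-1 * S w))%:E))%E).
  apply: ge0_le_integral => //.
  - exact/measurable_EFinP/measurable_indic.
  - by apply: emeasurable_funD; apply: emeasurable_funM => //; exact: mexp.
  - move=> w _; rewrite -!EFinM -EFinD lee_fin -!expRD indicE.
    case: (boolP (w \in E)) => [|_]; last by rewrite addr_ge0 ?expR_ge0.
    rewrite inE /E/= -/(S w) => hS.
    have : r * h < `|S w|.
      rewrite -(@ltr_pXn2r _ 2)// ?nnegrE ?mulr_ge0 ?ltW//.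
      by rewrite real_normK ?num_real// exprMn rn hr.
    rewrite lter_normr => /orP[hs|hs].
      have : 1 <= expR (- r + h^-1 * S w).
        apply: le_trans (expR_ge1Dx _); rewrite lerDl addrC subr_ge0.
        by rewrite mulrC ler_pdivlMr// ltW.
      by have := expR_ge0 (- r + - h^-1 * S w); lra.
    have : 1 <= expR (- r + - h^-1 * S w).
      apply: le_trans (expR_ge1Dx _); rewrite lerDl addrC subr_ge0.
      by rewrite mulNr -mulrN mulrC ler_pdivlMr// ltW.
    by have := expR_ge0 (- r + h^-1 * S w); lra.
rewrite ge0_integralD//; last 2 first.
- by apply: emeasurable_funM => //; exact: mexp.
- by apply: emeasurable_funM => //; exact: mexp.
have rn0 : r != 0 by rewrite gt_eqF.
have q1 : n%:R * (h^-1 ^+ 2 / 2) = r / 2 by rewrite -rn exprVn hr; field.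
rewrite !bnd// ?sqrrN// -EFinD lee_fin; lra.
Qed.
End std_gaussian.

Section top_eigenvalue_bound.
Context {R : realType} d (T : measurableType d) (P : probability T R).

Lemma probability_union_bound I (s : seq I) (D : set T) (G : I -> set T) (b : R) :
  measurable D -> (forall i, measurable (G i)) -> (forall i, P (G i) <= b%:E)%E ->
  (P (D `|` \big[setU/set0]_(i <- s) G i) <= P D + ((size s)%:R * b)%:E)%E.
Proof.
move=> mD mG Gb; elim: s => [|i s IH].
  by rewrite big_nil setU0 mul0r adde0.
rewrite big_cons setUCA.
have mU : measurable (D `|` \big[setU/set0]_(j <- s) G j).
  by apply: measurableU => //; exact: bigsetU_measurable.
apply: le_trans (measureU2 _ (mG i) mU) _.
rewrite [leRHS](_ : _ = b%:E + (P D + ((size s)%:R * b)%:E))%E; first exact: leeD (Gb i) IH.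
by rewrite addeCA -EFinD /= mulrS mulrDl mul1r.
Qed.

(** Testing the sample covariance on the [i]-th eigenvector bounds the sum of squares of the
    centered [y j]; undoing the centering adds the last term. *)
Lemma sumsq_le_of_eigenval n p (mu : 'cV[R]_p) (Sigma U : 'M[R]_p)
    (x : 'I_n -> 'cV[R]_p) (i : 'I_p) (lam0 : R)
    (y : 'I_n -> R) :
  (0 < p)%N -> (0 < n)%N -> 0 < eigenval Sigma i -> U^T *m U = 1%:M ->
  eigenval (sample_cov x) 0 <= lam0 ->
  (forall j, y j = (U^T *m (x j - mu)) i 0 / Num.sqrt (eigenval Sigma i)) ->
  \sum_j y j ^+ 2 <= n%:R * (lam0 / eigenval Sigma i) + (\sum_j y j) ^+ 2 / n%:R.
Proof.
move=> p0 n0 l0 UU /(eigenval0_leP_gt0 _ p0 (sample_cov_sym _))/(_ (col i U)).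
set l := eigenval Sigma i in l0 *.
have nR : 0 < n%:R :> R by rewrite ltr0n.
have -> : ((col i U)^T *m col i U) 0 0 = 1.
  have := congr1 (fun M : 'M[R]_p => M i i) UU; rewrite [RHS]mxE eqxx mulr1n => <-.
  by rewrite !mxE; apply: eq_bigr => k _; rewrite !mxE.
rewrite mulr1 quad_sample_cov => h ydef.
have s0 : Num.sqrt l != 0 by rewrite gt_eqF// sqrtr_gt0.
have colE (z : 'cV[R]_p) : ((col i U)^T *m z) 0 0 = (U^T *m z) i 0.
  by rewrite !mxE; apply: eq_bigr => k _; rewrite !mxE.
have yE j : ((col i U)^T *m (x j - sample_mean x)) 0 0 =
    Num.sqrt l * (y j - n%:R^-1 * \sum_k y k).
  rewrite colE (_ : x j - _ = (x j - mu) - n%:R^-1 *: \sum_k (x k - mu)); last first.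
    rewrite sumrB sumr_const card_ord scalerBr -[mu *+ n]scaler_nat scalerA mulVf ?gt_eqF//.
    by rewrite scale1r /sample_mean opprB addrA subrK.
  rewrite mulmxBr -scalemxAr mulmx_sumr [LHS]mxE [in X in _ + X]mxE [in X in _ + X]mxE summxE.
  have yK k : (U^T *m (x k - mu)) i 0 = Num.sqrt l * y k.
    by rewrite ydef mulrCA divff// mulr1.
  rewrite yK [RHS]mulrBr; congr (_ - _); rewrite [RHS]mulrCA; congr (_ * _).
  by rewrite mulr_sumr; apply: eq_bigr => k _.
move: h; under eq_bigr do rewrite yE exprMn sqr_sqrtr ?(ltW l0)//.
rewrite -mulr_sumr centered_sumsq//.
rewrite ler_pdivrMl// -ler_pdivlMl//.
rewrite lerBlDr => /le_trans; apply.
by rewrite lerD2r mulrCA [l^-1 * _]mulrC.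
Qed.

Lemma top_eigenvalue_bound n p (mu : 'cV[R]_p) (Sigma : 'M[R]_p)
    (X : 'I_n -> T -> 'cV[R]_p) (C : R) (S : {set 'I_p}) :
  (0 < p)%N -> (0 < n)%N -> posdefmx Sigma ->
  (forall j, normal_vector P mu Sigma (X j)) -> independent_vectors P X ->
  0 < C -> 40 * C <= Num.sqrt n%:R ->
  (forall i, i \in S -> n%:R * (eigenval Sigma 0 / eigenval Sigma i) +
     Num.sqrt n%:R <= n%:R + C * Num.sqrt n%:R) ->
  (P [set w | (eigenval (sample_cov (fun j => X j w)) 0 <= eigenval Sigma 0)%R] <=
  ((1 - tail_gap C) ^+ #|S| + p%:R * (2 * expR (- (Num.sqrt n%:R / 2))))%:E)%E.
Proof.
move=> p0 n0 pd nX iX C0 nC hS.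
have mX j : random_vector (X j) by exact: (nX j).1.
have [U UU [SE _ _]] := sym_spectral pd.1.
pose Y := std_coord mu Sigma U X.
have mY a : measurable_fun setT (Y a) by exact: measurable_std_coord.
have gY : std_gaussian_mgf P Y by exact: std_coord_gaussian.
set E := [set w | _].
have mE : measurable E by exact: measurable_eigenval0_le.
pose G i := [set w | (n%:R * Num.sqrt n%:R < (\sum_j Y (i, j) w) ^+ 2)%R].
have mG i : measurable (G i).
  by apply: measurable_set_gt; apply: measurable_funX; exact: measurable_sum.
(* Only the directions in [S] enter the joint tail, so that its exponent is [#|S|]. *)
pose sub (a : {i | i \in S} * 'I_n) : 'I_p * 'I_n := (val a.1, a.2).
have gY' : std_gaussian_mgf P (Y \o sub).
  by apply: std_gaussian_mgf_sub gY => -[a b] [a' b'] [/val_inj -> ->].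
have mY' a : measurable_fun setT ((Y \o sub) a) by exact: mY.
pose D := \bigcap_i [set w | (sumsq (Y \o sub) i w <= n%:R + C * Num.sqrt n%:R)%R].
have mD : measurable D.
  apply: fin_bigcap_measurable => [|i _]; first exact: finite_finset.
  by apply: measurable_set_le; exact: measurable_sumsq.
have PD : (P D <= ((1 - tail_gap C) ^+ #|S|)%:E)%E.
  by rewrite -card_sig; exact: joint_sumsq_tail.
(* Either some direction of [S] has a large sum, or the top eigenvalue bound forces all sums of
   squares over [S] below the threshold. The union runs over all [p] directions, whence the factor
   [p%:R]. *)
have ED : E `<=` D `|` \big[setU/set0]_(i <- enum 'I_p) G i.
  move=> w Ew.
  have [[i [iS Gi]]|noG] := pselect (exists i, i \in S /\ G i w).
    by right; rewrite -bigcup_seq/=; exists i => //=; rewrite mem_enum.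
  left => -[i iS] _ /=; apply: le_trans (hS i iS).
  apply: le_trans (sumsq_le_of_eigenval p0 n0 (posdef_eigenval_gt0 i pd) UU Ew (fun j => erefl)) _.
  rewrite lerD2l ler_pdivrMr ?ltr0n// mulrC.
  by rewrite leNgt; apply/negP => Gi; apply: noG; exists i.
have b1 i : (P (G i) <= (2 * expR (- (Num.sqrt n%:R / 2)))%:E)%E by exact: sum_tail.
apply: (@le_trans _ _ (P (D `|` \big[setU/set0]_(i <- enum 'I_p) G i))).
  apply: le_measure => //; rewrite ?inE//.
  by apply: measurableU => //; exact: bigsetU_measurable.
apply: le_trans (probability_union_bound (enum 'I_p) mD mG b1) _.
by rewrite size_enum_ord EFinD leeD.
Qed.
End top_eigenvalue_bound.

(** * Limits *)

(** An index of [J Sigma p] stays in [J Sigma p'], where the condition concerns fewer [m]. *)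
Lemma phi_nondecreasing (R : realType) (Sigma : forall p, 'M[R]_p) p p' :
  (p <= p')%N -> (phi Sigma p <= phi Sigma p')%N.
Proof.
move=> pp'; have widen_inj : injective (widen_ord pp').
  by move=> i i' /(congr1 val) /= e; exact: val_inj.
rewrite /phi -(card_imset (mem (J Sigma p)) widen_inj).
apply: subset_leq_card; apply/fintype.subsetP => _ /imsetP[i iJ ->].
move: iJ; rewrite !inE => /asboolP h; apply/asboolP => m p'm.
by apply: h; exact: leq_trans p'm.
Qed.

(** The 1 pays for the sample mean. The other term pays for the ratio of eigenvalues: its deviation
    1 / sqrt p, multiplied by [n], is sqrt n / sqrt q. *)
Definition tail_const (R : realType) (q : R) : R := 1 + (Num.sqrt q)^-1.

Lemma sample_prob_bound (R : realType) (q : R) (Sigma : forall p, 'M[R]_p) p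
    (mu : 'cV[R]_p) d (T : measurableType d) (P : probability T R)
    (X : 'I_(sample_size q p) -> T -> 'cV[R]_p) :
  0 < q < 1 -> admissible q p -> posdefmx (Sigma p) ->
  (forall i, normal_vector P mu (Sigma p) (X i)) -> independent_vectors P X ->
  40 * tail_const q <= Num.sqrt p%:R ->
  (P [set w | (eigenval (sample_cov (fun i => X i w)) 0 <= eigenval (Sigma p) 0)%R] <=
  ((1 - tail_gap (tail_const q)) ^+ phi Sigma p + 96 / Num.sqrt p%:R)%:E)%E.
Proof.
move=> /andP[q0 q1] [p0 pq] pd nX iX hp.
set n := sample_size q p in X nX iX *.
have pR : 0 < p%:R :> R by rewrite ltr0n.
have nE : n%:R = p%:R / q :> R by rewrite /n /sample_size truncnK.
have pn : p%:R <= n%:R :> R by rewrite nE ler_pdivlMr// ler_piMr// ltW.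
have nR : 0 < n%:R :> R by exact: lt_le_trans pn.
have n0 : (0 < n)%N by rewrite -(ltr0n R).
have sq0 : 0 < Num.sqrt q by rewrite sqrtr_gt0.
have C0 : 0 < tail_const q by rewrite addr_gt0// invr_gt0.
pose r : R := Num.sqrt n%:R.
have r0 : 0 < r by rewrite sqrtr_gt0.
have rn : r ^+ 2 = n%:R by rewrite sqr_sqrtr.
have sp0 : 0 < Num.sqrt p%:R :> R by rewrite sqrtr_gt0.
have spr : Num.sqrt p%:R <= r by rewrite ler_sqrt// ltW.
have spE : Num.sqrt p%:R = Num.sqrt q * r.
  rewrite -sqrtrM ?(ltW q0)//; congr Num.sqrt; rewrite nE; field.
  by rewrite gt_eqF.
have hJ i : i \in J Sigma p ->
    n%:R * (eigenval (Sigma p) 0 / eigenval (Sigma p) i) + r <= n%:R + tail_const q * r.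
  rewrite inE => /asboolP/(_ p (leqnn p)) /ltr_normlW.
  set x := _ / eigenval _ _ => hx.
  have : n%:R * x <= n%:R * (1 + (Num.sqrt p%:R)^-1).
    by rewrite ler_wpM2l//; lra.
  rewrite (_ : n%:R * (1 + _) = n%:R + (Num.sqrt q)^-1 * r); last first.
    rewrite spE -rn; field.
    by rewrite !gt_eqF.
  rewrite /tail_const; lra.
apply: le_trans (top_eigenvalue_bound p0 n0 pd nX iX C0 (le_trans hp spr) hJ) _.
rewrite lee_fin lerD2l -/r.
(* The cubic term of the exponential series suffices: with [p <= n], the error is at most n * 2 * 48
   / r^3 = 96 / r. *)
have e1 : r ^+ 3 / 48 <= expR (r / 2).
  have := @expR_ge1Dxn R (r / 2) 2 ltac:(lra).
  rewrite (_ : 3`!%:R = 6)// => h.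
  by apply: le_trans h; rewrite (_ : (r / 2) ^+ 3 / 6 = r ^+ 3 / 48) ?lerDr//; field.
have r30 : 0 < r ^+ 3 by rewrite exprn_gt0.
have e2 : expR (- (r / 2)) <= 48 / r ^+ 3.
  rewrite expRN -[48 / _]invrK lef_pV2 ?posrE ?expR_gt0 ?invr_gt0 ?divr_gt0//.
  by rewrite invf_div.
apply: (@le_trans _ _ (n%:R * (2 * (48 / r ^+ 3)))).
  by rewrite ler_pM ?mulr_ge0 ?expR_ge0// ler_wpM2l.
rewrite -rn (_ : _ * _ = 96 / r); last by field; rewrite gt_eqF.
by rewrite ler_wpM2l// lef_pV2 ?posrE.
Qed.

Lemma near_limf_esup_le (R : realType) (u : nat -> \bar R) (F : set_system nat) (l : R) :
  (forall e : R, 0 < e -> F [set p | (u p <= (l + e)%:E)%E]) ->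
  (limf_esup u F <= l%:E)%E.
Proof.
move=> h; apply/lee_addgt0Pr => e e0; rewrite -EFinD.
apply: (@le_trans _ _ (ereal_sup (u @` [set p | (u p <= (l + e)%:E)%E]))).
  by apply: ereal_inf_lbound; exists [set p | (u p <= (l + e)%:E)%E] => //; exact: h.
by apply: ge_ereal_sup => _ [p up <-].
Qed.

(** For [phi] these alternatives are the finite and the infinite limit, treated separately in the
    final proof. *)
Lemma nat_sup_or_unbounded (f : nat -> nat) :
  {homo f : p p' / (p <= p')%N} ->
  (exists p0, forall p, (p0 <= p)%N -> f p = f p0) \/
  (forall K, exists p0, forall p, (p0 <= p)%N -> (K <= f p)%N).
Proof.
move=> fm; have [[K hK]|nb] := pselect (exists K, forall p, (f p <= K)%N).
  left; have ex : exists k, `[< exists p, f p = k >] by exists (f 0%N); apply/asboolP; exists 0%N.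
  have ub k : `[< exists p, f p = k >] -> (k <= K)%N by move=> /asboolP[p <-].
  case: (ex_maxnP ex ub) => k /asboolP[p0 <-] kmax; exists p0 => p pp0.
  apply/eqP; rewrite eqn_leq; apply/andP; split; last exact: fm.
  by apply: kmax; apply/asboolP; exists p.
right=> K; have [p0 hp0] : exists p0, (K <= f p0)%N.
  apply: contrapT => /forallNP h; apply: nb; exists K => p.
  by rewrite leqNgt; apply/negP => /ltnW; exact: h.
by exists p0 => p /fm; exact: leq_trans.
Qed.


Theorem mainTheorem1 (R : realType) (q : R) (hq : 0 < q < 1)
  (Sigma : forall p : nat, 'M[R]_p)
  (hSigma : forall p, (0 < p)%N -> posdefmx (Sigma p))
  (mu : forall p : nat, 'cV[R]_p)
  (d : nat -> measure_display) (T : forall p, measurableType (d p))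
  (P : forall p, probability (T p) R)
  (X : forall p, 'I_(sample_size q p) -> T p -> 'cV[R]_p)
  (hnormal : forall p, admissible q p ->
     forall i, normal_vector (P p) (mu p) (Sigma p) (X p i))
  (hindep : forall p, admissible q p -> independent_vectors (P p) (X p)) :
  let prob p := P p [set w | eigenval (sample_cov (fun i => X p i w)) 0
                             <= eigenval (Sigma p) 0] in
  (forall p p', (0 < p <= p')%N -> (phi Sigma p <= phi Sigma p')%N) /\
  exists L : \bar R,
    [/\ (0 <= L)%E,
        (phi Sigma p)%:R%:E @[p --> \oo] --> L,
        exists2 c : R, 0 < c &
          (limf_esup prob (within (admissible q) \oo)
             <= limn_esup (fun p => (expR (- (c * (phi Sigma p)%:R)))%:E))%E /\
          limn_esup (fun p => (expR (- (c * (phi Sigma p)%:R)))%:E)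
             = expeR (- (c%:E * L)) &
        L = +oo%E -> prob p @[p --> within (admissible q) \oo] --> 0%E].
Proof.
move=> prob; split; first by move=> p p' /andP[_]; exact: phi_nondecreasing.
pose C := tail_const q; pose rho := 1 - tail_gap C.
have C0 : 0 < C by rewrite addr_gt0// invr_gt0 sqrtr_gt0; case/andP: hq.
have /andP[rho0 rho1] : 0 < rho < 1.
  by have /andP[? ?] := tail_gapP C0; apply/andP; split; rewrite /rho; lra.
(* This makes [expR (- (c * k%:R))] equal to [rho ^+ k]. *)
pose c := - ln rho.
have c0 : 0 < c by rewrite oppr_gt0 ln_lt0// rho0.
have rhoE (k : nat) : expR (- (c * k%:R)) = rho ^+ k.
  by rewrite -mulNr opprK expRM_natr lnK// posrE.
have near_prob (l e : R) : (\forall p \near \oo, rho ^+ phi Sigma p <= l) -> 0 < e ->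
    \forall p \near within (admissible q) \oo, (prob p <= (l + e)%:E)%E.
  (* Once [p] exceeds [x], sqrt p is at least [40 * C], as [sample_prob_bound] requires, and at
     least [96 / e], so the error term is at most [e]. *)
  move=> [N1 _ h1] e0; pose x := (40 * C) ^+ 2 + (96 / e) ^+ 2.
  exists (maxn N1 (Num.truncn x).+1) => // p /=; rewrite geq_max => /andP[pN1 px] ap.
  have xp : x <= p%:R.
    apply: le_trans (ltW (truncnS_gt _)) _.
    by rewrite ler_nat.
  have pR : 0 < p%:R :> R by rewrite ltr0n; case: ap.
  have sp0 : 0 < Num.sqrt p%:R :> R by rewrite sqrtr_gt0.
  have le_sp y : 0 <= y -> y ^+ 2 <= p%:R -> y <= Num.sqrt p%:R.
    by move=> y0 yp; rewrite -(@ler_pXn2r _ 2)// ?nnegrE ?sqrtr_ge0// sqr_sqrtr// ltW.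
  apply: le_trans (sample_prob_bound hq ap (hSigma _ (proj1 ap)) (hnormal _ ap) (hindep _ ap) _) _.
    apply: le_sp; first by rewrite mulr_ge0// ltW.
    by apply: le_trans xp; rewrite lerDl sqr_ge0.
  rewrite lee_fin lerD//; first exact: h1.
  rewrite ler_pdivrMr// mulrC -ler_pdivrMr//; apply: le_sp; first by rewrite divr_ge0// ltW.
  by apply: le_trans xp; rewrite lerDr sqr_ge0.
have [[p0 hp0]|unb] := nat_sup_or_unbounded (@phi_nondecreasing _ Sigma).
  (* Bounded case: [phi] is eventually constant, and the implication from [L = +oo] is vacuous. *)
  exists (phi Sigma p0)%:R%:E; split => //.
  - by apply: cvg_near_cst; exists p0 => // p /= /hp0 ->.
  exists c => //.
  have ev : \forall p \near \oo, rho ^+ phi Sigma p <= rho ^+ phi Sigma p0.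
    by exists p0 => // p /= /hp0 ->.
  have cu : (expR (- (c * (phi Sigma p)%:R)))%:E @[p --> \oo] -->
      (rho ^+ phi Sigma p0)%:E.
    by apply: cvg_near_cst; exists p0 => // p /= /hp0 ->; rewrite rhoE.
  have -> : limn_esup (fun p => (expR (- (c * (phi Sigma p)%:R)))%:E) =
      (rho ^+ phi Sigma p0)%:E.
    rewrite is_cvg_limn_esupE; first exact: cvg_lim cu.
    by apply/cvg_ex; eexists; exact: cu.
  split; last by rewrite /= rhoE.
  by apply: near_limf_esup_le => e e0; exact: near_prob.
(* Unbounded case: [rho ^+ phi Sigma p] tends to 0, and therefore so do the probabilities. *)
have near0 (e : R) : 0 < e -> \forall p \near \oo, rho ^+ phi Sigma p <= e.
  move=> e0; have : rho ^+ k @[k --> \oo] --> 0.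
    by apply: cvg_expr; rewrite ger0_norm// ltW.
  move=> /cvgrPdist_le/(_ e e0)[K _ hK]; have [p0 hp0] := unb K.
  exists p0 => // p /= /hp0/(hK _); rewrite sub0r normrN.
  by rewrite ger0_norm// exprn_ge0// ltW.
have near_prob0 (e : R) : 0 < e ->
    \forall p \near within (admissible q) \oo, (prob p <= e%:E)%E.
  move=> e0; have e20 : 0 < e / 2 by rewrite divr_gt0.
  by rewrite [e]splitr; apply: near_prob => //; exact: near0.
exists +oo%E; split => //.
- apply/cvgeyPge => A; have [p0 hp0] := unb (Num.truncn A).+1.
  exists p0 => // p /= /hp0 h; rewrite lee_fin.
  (* Truncation bounds [A] only when [A] is nonnegative; a negative [A] lies below every value of
     [phi]. *)
  have [A0|A0] := leP 0 A; last by rewrite (le_trans (ltW A0)).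
  by apply: le_trans (ltW (truncnS_gt _)) _; rewrite ?ler_nat.
- exists c => //.
  have -> : limn_esup (fun p => (expR (- (c * (phi Sigma p)%:R)))%:E) = 0%E.
    have cu : (expR (- (c * (phi Sigma p)%:R)))%:E @[p --> \oo] --> 0%:E.
      apply: cvg_EFin; first by near=> p.
      apply/cvgrPdist_le => e /near0[p0 _ hp0]; exists p0 => // p /= /hp0.
      by rewrite sub0r normrN ger0_norm ?expR_ge0// rhoE.
    rewrite is_cvg_limn_esupE; first exact: cvg_lim cu.
    by apply/cvg_ex; eexists; exact: cu.
  split; last by rewrite gt0_muley ?lte_fin.
  by apply: near_limf_esup_le => e e0; rewrite add0r; exact: near_prob0.
move=> _.
have finP (e : R) p : (prob p <= e%:E)%E -> prob p \is a fin_num.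
  by move=> pe; rewrite ge0_fin_numE ?measure_ge0// (le_lt_trans pe) ?ltry.
apply/fine_cvgP; split.
  by apply: filterS (near_prob0 1 ltr01) => p; exact: finP.
apply/cvgrPdist_le => e e0; apply: filterS (near_prob0 e e0) => p pe.
rewrite sub0r normrN /= ger0_norm ?fine_ge0 ?measure_ge0//.
by rewrite -lee_fin fineK// (finP e).
Unshelve. all: by end_near.
Qed.
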